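(* For $\xi\in\mathbb R$ let $g_\xi(x)=e^{2\pi i\xi x}$ on $[-1/2,1/2]$ and let $T_{g_\xi}$ be the Toeplitz operator with symbol $g_\xi$. Then: (1) if $\xi<-1/2$, $T_{g_\xi}$ is not injective; (2) if $-1/2<\xi<1/2$, $T_{g_\xi}$ is invertible; (3) if $\xi=-1/2+n$ for some $n\in\{0,1,2,\dots\}$, $T_{g_\xi}$ is injective but not bounded below; (4) if $\xi>1/2$ and $\xi\neq -1/2+n$ for all $n\in\{0,1,2,\dots\}$, $T_{g_\xi}$ is injective and bounded below but not surjective.
   Context: For $\phi\in L^1[-1/2,1/2]$, $\widehat\phi(n)=\int_{-1/2}^{1/2}\phi(x)e^{-2\pi i n x}\,dx$. Let $\tilde H^2=\{f\in L^2[-1/2,1/2]:\widehat f(n)=0 \text{ for all } n<0\}$ and $P_+$ the orthogonal projection of $L^2[-1/2,1/2]$ onto $\tilde H^2$. For $\phi\in L^\infty[-1/2,1/2]$ the Toeplitz operator $T_\phi:\tilde H^2\to\tilde H^2$ is $T_\phi f=P_+(\phi f)$ (matrix entries $\widehat\phi(j-k)$, $j,k\ge0$, in the basis $\{e^{2\pi i n x}\}_{n\ge0}$). An operator $T$ is bounded below if there is $c>0$ with $\|Tf\|\ge c\|f\|$ for all $f$. *)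

(* Defs.v *)
From Stdlib Require Import Reals Lra ZArith.
Open Scope R_scope.

Definition C := (R * R)%type.
Definition Cmul (a b : C) : C :=
  (fst a * fst b - snd a * snd b, fst a * snd b + snd a * fst b).
Definition Cnorm2 (a : C) : R := fst a ^ 2 + snd a ^ 2.

Lemma trig_integrable (f : R -> R) (t : R) (Hf : continuity f) :
  Riemann_integrable (fun x => f (t * x)) (-1/2) (1/2).
Proof.
  apply continuity_implies_RiemannInt; [lra|].
  intros x _. apply continuity_pt_comp with (f1 := fun x => t * x).
  - apply continuity_pt_mult; [apply continuity_pt_const; intros ?? ; reflexivity
                              | apply derivable_continuous_pt, derivable_pt_id].
  - apply Hf.
Qed.

(* g_xi(x) = exp(2 pi i xi x) on [-1/2,1/2]; its Fourier coefficient
   ghat xi n = \int_{-1/2}^{1/2} g_xi(x) e^{-2 pi i n x} dx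
             = \int cos(2pi(xi-n)x) dx + i \int sin(2pi(xi-n)x) dx. *)
Definition ghat (xi : R) (n : Z) : C :=
  (RiemannInt (trig_integrable cos (2 * PI * (xi - IZR n)) continuity_cos),
   RiemannInt (trig_integrable sin (2 * PI * (xi - IZR n)) continuity_sin)).

(* Elements of H^2 are identified (via their Fourier coefficients, an
   isometric isomorphism) with square-summable complex sequences on nat. *)
Definition seqC := nat -> C.

Definition l2norm2 (f : seqC) (l : R) : Prop :=
  infinite_sum (fun k => Cnorm2 (f k)) l.

Definition is_l2 (f : seqC) : Prop := exists l, l2norm2 f l.

Definition toeplitz (xi : R) (f h : seqC) : Prop :=
  forall j : nat,
    infinite_sum (fun k => fst (Cmul (ghat xi (Z.of_nat j - Z.of_nat k)) (f k))) (fst (h j)) /\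
    infinite_sum (fun k => snd (Cmul (ghat xi (Z.of_nat j - Z.of_nat k)) (f k))) (snd (h j)).

Definition zeroC : seqC := fun _ => (0, 0).

Definition T_injective (xi : R) : Prop :=
  forall f, is_l2 f -> toeplitz xi f zeroC -> forall k, f k = (0, 0).

Definition T_bounded_below (xi : R) : Prop :=
  exists c, 0 < c /\
    forall f h nf nh, is_l2 f -> toeplitz xi f h ->
      l2norm2 f nf -> l2norm2 h nh -> sqrt nh >= c * sqrt nf.

Definition T_surjective (xi : R) : Prop :=
  forall h, is_l2 h -> exists f, is_l2 f /\ toeplitz xi f h.

(* Invertible bounded operator: bijective with bounded inverse
   (bounded inverse <-> bounded below). *)
Definition T_invertible (xi : R) : Prop :=
  T_injective xi /\ T_surjective xi /\ T_bounded_below xi.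

(* Main.v *)
(** The imaginary part of [ghat] vanishes, so T_xi acts separately on real and imaginary
    parts of a sequence, with the real matrix [sinc (xi - j + k)], and finite sections of
    its quadratic form are integrals of trigonometric polynomials against g_xi. Hence
    operators with symbol bounded by M have norm at most M.

    For |xi| < 1/2 the real part of g_xi is at least c = cos (PI xi) > 0, so
    |1 - (c/2) g_xi| < 1 uniformly and T_xi is inverted by a Neumann series. At xi = -1/2
    the real part is cos (PI x) >= cos (PI x)^2 = |1 + e^{2 PI i x}|^2 / 4, so T f = 0
    forces f_k + f_{k-1} = 0 for all k, that is f = 0. Since T_{xi+n} = T_xi S^n with S
    the unilateral shift, injectivity, boundedness below and non-surjectivity carry over to
    larger xi.

    For xi < -1/2 the coefficients of (1 + z)^{-xi-1} are square-summable and lie in the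
    kernel. As ||T_a - T_b|| <= PI |a - b|, those for xi = -1/2 - d show that T_{-1/2}
    is not bounded below. *)

(* Origin of the kernel vectors: with z = e^{2 PI i x} on the cut circle, 1 + z = z (1 + 1/z) gives
   g_xi = z^xi = (1 + z)^xi (1 + 1/z)^{-xi}. Hence g_xi (1 + z)^{-xi-1} = z^{-1} (1 + 1/z)^{-xi-1}
   has negative frequencies only, and P_+ kills it. Near z = -1 the function |1 + z|^{-xi-1} is
   square-integrable exactly for xi < -1/2. The proof stays with coefficients: a telescoping
   identity links consecutive entries of T_xi f and makes them all vanish. At xi = -1/2 two things
   degenerate. The real part of the symbol vanishes at both ends of the interval, so the Neumann
   margin is lost and the lower bound by |1 + z|^2 / 4 controls each f_k + f_{k-1} but no longer the
   norm of f. The candidate kernel vector also just fails to be square-summable, its squared norm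
   diverging like a logarithm; this divergence is what defeats boundedness below. *)
From Stdlib Require Import Reals Lra Lia ZArith Classical.
From Coquelicot Require Import Rbar Rcomplements Hierarchy Lim_seq Series RInt
  RInt_analysis Derive AutoDerive Continuity.
Require Import Defs.
Open Scope R_scope.

(** * Toeplitz forms as integrals of trigonometric polynomials *)

(* Coquelicot states these equalities in the carrier of [R_NormedModule], which [ring] does
   not recognise as [R]. *)
Ltac real_eq := lazymatch goal with |- @eq _ ?a ?b => change (@eq R a b) end.

(** Real part of the d-th Fourier coefficient of A + iB. The imaginary part is dropped: it vanishes
    when A is even and B is odd, as for all combinations of the g_xi with real coefficients. *)
Definition kern (A B : R -> R) (d : R) : R :=
  RInt (fun x => A x * cos (2 * PI * d * x) + B x * sin (2 * PI * d * x))
    (-1/2) (1/2).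

Definition bil (A B : R -> R) (h f : nat -> R) (n : nat) : R :=
  sum_f_R0 (fun j => h j *
    sum_f_R0 (fun k => kern A B (INR j - INR k) * f k) n) n.

Definition tcos (f : nat -> R) (n : nat) (x : R) : R :=
  sum_f_R0 (fun k => f k * cos (2 * PI * INR k * x)) n.

Definition tsin (f : nat -> R) (n : nat) (x : R) : R :=
  sum_f_R0 (fun k => f k * sin (2 * PI * INR k * x)) n.

Lemma continuous_cos_lin (t x : R) : continuous (fun x => cos (t * x)) x.
Proof.
  apply (@ex_derive_continuous R_AbsRing R_NormedModule). auto_derive. auto.
Qed.

Lemma continuous_sin_lin (t x : R) : continuous (fun x => sin (t * x)) x.
Proof.
  apply (@ex_derive_continuous R_AbsRing R_NormedModule). auto_derive. auto.
Qed.

Lemma continuous_kern_integrand (A B : R -> R) (d x : R) :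
  continuous A x -> continuous B x ->
  continuous (fun x => A x * cos (2 * PI * d * x) + B x * sin (2 * PI * d * x)) x.
Proof.
  intros HA HB.
  apply (continuous_plus (fun x => A x * cos (2 * PI * d * x))
           (fun x => B x * sin (2 * PI * d * x))).
  - apply (continuous_mult A (fun x => cos (2 * PI * d * x)));
      [exact HA | apply continuous_cos_lin].
  - apply (continuous_mult B (fun x => sin (2 * PI * d * x)));
      [exact HB | apply continuous_sin_lin].
Qed.

Lemma is_RInt_kern (A B : R -> R) (d : R) :
  (forall x, continuous A x) -> (forall x, continuous B x) ->
  is_RInt (fun x => A x * cos (2 * PI * d * x) + B x * sin (2 * PI * d * x))
    (-1/2) (1/2) (kern A B d).
Proof.
  intros HA HB. apply (@RInt_correct R_CompleteNormedModule).
  apply (@ex_RInt_continuous R_CompleteNormedModule).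
  intros x _. apply continuous_kern_integrand; auto.
Qed.

Lemma is_RInt_sum (F : nat -> R -> R) (I : nat -> R) (a b : R) (n : nat) :
  (forall k, is_RInt (F k) a b (I k)) ->
  is_RInt (fun x => sum_f_R0 (fun k => F k x) n) a b (sum_f_R0 I n).
Proof.
  intros H. induction n as [|n IH]; simpl; [apply H|].
  apply (is_RInt_plus (fun x => sum_f_R0 (fun k => F k x) n) (F (S n))); auto.
Qed.

Lemma sum_shifted_character (f : nat -> R) (a b : R) (j : R) (x : R) (n : nat) :
  sum_f_R0 (fun k => (a * cos (2 * PI * (j - INR k) * x) +
                      b * sin (2 * PI * (j - INR k) * x)) * f k) n =
  a * (cos (2 * PI * j * x) * tcos f n x + sin (2 * PI * j * x) * tsin f n x) +
  b * (sin (2 * PI * j * x) * tcos f n x - cos (2 * PI * j * x) * tsin f n x).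
Proof.
  assert (H : forall k, (a * cos (2 * PI * (j - INR k) * x) +
                      b * sin (2 * PI * (j - INR k) * x)) * f k =
     (a * (cos (2*PI*j*x) * cos (2*PI*INR k*x) + sin (2*PI*j*x) * sin (2*PI*INR k*x))
    + b * (sin (2*PI*j*x) * cos (2*PI*INR k*x) - cos (2*PI*j*x) * sin (2*PI*INR k*x)))
     * f k).
  { intros k.
    replace (2 * PI * (j - INR k) * x) with (2*PI*j*x - 2*PI*INR k*x) by ring.
    rewrite cos_minus, sin_minus. ring. }
  unfold tcos, tsin. induction n as [|n IH].
  - cbn [sum_f_R0]. rewrite H. ring.
  - rewrite !tech5, IH, H. ring.
Qed.

(** With F = [tcos f] + i [tsin f] and H likewise, the integrand is the real part of (A + iB) F
    conj(H). Pointwise facts about the symbol thus become facts about finite sections. *)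
Lemma is_RInt_bil (A B : R -> R) (h f : nat -> R) (n : nat) :
  (forall x, continuous A x) -> (forall x, continuous B x) ->
  is_RInt (fun x => A x * (tcos h n x * tcos f n x + tsin h n x * tsin f n x) +
                    B x * (tsin h n x * tcos f n x - tcos h n x * tsin f n x))
    (-1/2) (1/2) (bil A B h f n).
Proof.
  intros HA HB.
  apply (is_RInt_ext (fun x => sum_f_R0 (fun j => h j *
    sum_f_R0 (fun k => (A x * cos (2 * PI * (INR j - INR k) * x) +
                      B x * sin (2 * PI * (INR j - INR k) * x)) * f k) n) n)).
  - intros x _.
    rewrite (sum_eq _ (fun j => h j *
       (A x * (cos (2*PI*INR j*x) * tcos f n x + sin (2*PI*INR j*x) * tsin f n x)
      + B x * (sin (2*PI*INR j*x) * tcos f n x - cos (2*PI*INR j*x) * tsin f n x)))).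
    2: { intros j _. now rewrite sum_shifted_character. }
    set (c := tcos f n x). set (s := tsin f n x). unfold tcos, tsin.
    clearbody c s. real_eq. induction n as [|m IH]; simpl; [ring|].
    rewrite IH. ring.
  - unfold bil.
    apply (is_RInt_sum (fun j x => h j *
      sum_f_R0 (fun k => (A x * cos (2 * PI * (INR j - INR k) * x) +
                      B x * sin (2 * PI * (INR j - INR k) * x)) * f k) n)).
    intros j.
    apply (is_RInt_scal (fun x => sum_f_R0 (fun k =>
          (A x * cos (2 * PI * (INR j - INR k) * x) +
           B x * sin (2 * PI * (INR j - INR k) * x)) * f k) n) _ _ (h j)).
    apply (is_RInt_sum (fun k x => (A x * cos (2 * PI * (INR j - INR k) * x) +
                      B x * sin (2 * PI * (INR j - INR k) * x)) * f k)).
    intros k.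
    apply (is_RInt_ext (fun x => scal (f k) (A x * cos (2 * PI * (INR j - INR k) * x) +
                      B x * sin (2 * PI * (INR j - INR k) * x)))).
    { intros x _. real_eq. unfold scal; simpl; unfold mult; simpl. ring. }
    replace (kern A B (INR j - INR k) * f k)
      with (scal (f k) (kern A B (INR j - INR k)))
      by (unfold scal; simpl; unfold mult; simpl; ring).
    apply (is_RInt_scal (fun x => A x * cos (2 * PI * (INR j - INR k) * x) +
                      B x * sin (2 * PI * (INR j - INR k) * x))).
    now apply is_RInt_kern.
Qed.

(** * Fourier coefficients of g_xi *)

Definition gcos (xi x : R) : R := cos (2 * PI * xi * x).
Definition gsin (xi x : R) : R := sin (2 * PI * xi * x).

(** The function sin (PI t) / (PI t) with its singularity at 0 removed; defining it as an integral
    avoids a case distinction. *)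
Definition sinc (t : R) : R := kern (gcos t) (gsin t) 0.

Lemma kern_g (xi d : R) : kern (gcos xi) (gsin xi) d = sinc (xi - d).
Proof.
  unfold sinc, kern. apply RInt_ext. intros x _. real_eq. unfold gcos, gsin.
  replace (2 * PI * (xi - d) * x) with (2 * PI * xi * x - 2 * PI * d * x) by ring.
  replace (2 * PI * 0 * x) with 0 by ring.
  rewrite cos_minus, cos_0, sin_0. ring.
Qed.

Lemma sinc_RInt (t : R) : sinc t = RInt (fun x => cos (2 * PI * t * x)) (-1/2) (1/2).
Proof.
  unfold sinc, kern. apply RInt_ext. intros x _. real_eq. unfold gcos, gsin.
  replace (2 * PI * 0 * x) with 0 by ring. rewrite cos_0, sin_0. ring.
Qed.

Lemma sinc_0 : sinc 0 = 1.
Proof.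
  rewrite sinc_RInt, (RInt_ext _ (fun _ => 1)).
  - rewrite RInt_const. unfold scal; simpl; unfold mult; simpl. field.
  - intros x _. replace (2 * PI * 0 * x) with 0 by ring. apply cos_0.
Qed.

Lemma sinc_neq0 (t : R) : t <> 0 -> sinc t = sin (PI * t) / (PI * t).
Proof.
  intros Ht. pose proof PI_RGT_0 as HPI. rewrite sinc_RInt.
  apply is_RInt_unique.
  replace (sin (PI * t) / (PI * t)) with
    (minus (sin (2 * PI * t * (1/2)) / (2 * PI * t))
           (sin (2 * PI * t * (-1/2)) / (2 * PI * t))).
  - apply (is_RInt_derive (fun x => sin (2 * PI * t * x) / (2 * PI * t))).
    + intros x _. auto_derive; [auto|]. field. lra.
    + intros x _. apply continuous_cos_lin.
  - real_eq. unfold minus, plus, opp; simpl.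
    replace (2 * PI * t * (1/2)) with (PI * t) by field.
    replace (2 * PI * t * (-1/2)) with (- (PI * t)) by field.
    rewrite sin_neg. field. lra.
Qed.

Lemma sin_PI_IZR (z : Z) : sin (PI * IZR z) = 0.
Proof. apply sin_eq_0_1. exists z. ring. Qed.

Lemma sinc_IZR (z : Z) : z <> 0%Z -> sinc (IZR z) = 0.
Proof.
  intros Hz. assert (IZR z <> 0) by (now apply not_0_IZR).
  rewrite sinc_neq0 by assumption. rewrite sin_PI_IZR. unfold Rdiv. ring.
Qed.

Lemma sinc_nat_diff (j k : nat) :
  sinc (INR j - INR k) = if Nat.eq_dec j k then 1 else 0.
Proof.
  destruct (Nat.eq_dec j k) as [->|H].
  - rewrite Rminus_diag. apply sinc_0.
  - rewrite !INR_IZR_INZ, <- minus_IZR. apply sinc_IZR. lia.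
Qed.

Lemma ghat_sinc (xi : R) (n : Z) : ghat xi n = (sinc (xi - IZR n), 0).
Proof.
  unfold ghat. f_equal.
  - rewrite <- RInt_Reals, sinc_RInt. reflexivity.
  - rewrite <- RInt_Reals. set (t := 2 * PI * (xi - IZR n)).
    clearbody t. apply is_RInt_unique. destruct (Req_dec t 0) as [->|Ht].
    + apply (is_RInt_ext (fun _ => 0)).
      { intros x _. rewrite Rmult_0_l. symmetry. apply sin_0. }
      pose proof (is_RInt_const (V := R_NormedModule) (-1/2) (1/2) 0) as H.
      unfold scal in H; simpl in H; unfold mult in H; simpl in H.
      now rewrite Rmult_0_r in H.
    + replace 0 with (minus (- cos (t * (1/2)) / t) (- cos (t * (-1/2)) / t)).
      * apply (is_RInt_derive (fun x => - cos (t * x) / t)).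
        -- intros x _. auto_derive; [auto|]. field. exact Ht.
        -- intros x _. apply continuous_sin_lin.
      * real_eq. unfold minus, plus, opp; simpl.
        replace (t * (-1/2)) with (- (t * (1/2))) by field.
        rewrite cos_neg. ring.
Qed.

(** * Square-summable sequences *)

Definition L2 (f : nat -> R) : Prop := ex_series (fun k => f k ^ 2).
Definition nrm (f : nat -> R) : R := sqrt (Series (fun k => f k ^ 2)).

Lemma is_series_lim (a : nat -> R) (l : R) :
  is_series a l <-> is_lim_seq (sum_f_R0 a) l.
Proof.
  split; intros H.
  - apply (is_lim_seq_ext (sum_n a)); [|exact H]. intros n. apply sum_n_Reals.
  - apply (is_lim_seq_ext _ (sum_n a)) in H; [exact H|].
    intros n. symmetry. apply sum_n_Reals.
Qed.

Lemma Series_lim (a : nat -> R) :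
  ex_series a -> is_lim_seq (sum_f_R0 a) (Series a).
Proof. intros H. now apply is_series_lim, Series_correct. Qed.

Lemma sum_le_extend (a : nat -> R) (m n : nat) :
  (forall k, 0 <= a k) -> (m <= n)%nat -> sum_f_R0 a m <= sum_f_R0 a n.
Proof.
  intros Ha Hmn. induction Hmn as [|n _ IH]; [lra|].
  simpl. specialize (Ha (S n)). lra.
Qed.

Lemma Series_nonneg (a : nat -> R) :
  (forall k, 0 <= a k) -> ex_series a -> 0 <= Series a.
Proof.
  intros Ha H.
  apply (is_lim_seq_le (fun _ => 0) (sum_f_R0 a) 0 (Series a));
    [intros n; now apply cond_pos_sum | apply is_lim_seq_const | now apply Series_lim].
Qed.

Lemma sum_le_Series (a : nat -> R) (n : nat) :
  (forall k, 0 <= a k) -> ex_series a -> sum_f_R0 a n <= Series a.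
Proof.
  intros Ha H. apply (is_lim_seq_incr_compare (sum_f_R0 a)); [now apply Series_lim|].
  intros m. apply sum_le_extend; auto.
Qed.

Lemma sum_bounded_Series (a : nat -> R) (M : R) :
  (forall k, 0 <= a k) -> (forall n, sum_f_R0 a n <= M) ->
  ex_series a /\ Series a <= M.
Proof.
  intros Ha HM.
  assert (He : ex_series a).
  { destruct (ex_finite_lim_seq_incr (sum_f_R0 a) M) as [l Hl]; auto.
    - intros n. apply sum_le_extend; auto.
    - exists l. now apply is_series_lim. }
  split; [exact He|].
  apply (is_lim_seq_le (sum_f_R0 a) (fun _ => M) (Series a) M);
    [auto | now apply Series_lim | apply is_lim_seq_const].
Qed.

Lemma nrm_nonneg (f : nat -> R) : 0 <= nrm f.
Proof. apply sqrt_pos. Qed.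

Lemma nrm_sqr (f : nat -> R) : L2 f -> nrm f ^ 2 = Series (fun k => f k ^ 2).
Proof.
  intros H. unfold nrm. rewrite <- Rsqr_pow2, Rsqr_sqrt; [reflexivity|].
  apply Series_nonneg; [intros k; apply pow2_ge_0 | exact H].
Qed.

Lemma sum_le_nrm (f : nat -> R) (n : nat) :
  L2 f -> sum_f_R0 (fun k => f k ^ 2) n <= nrm f ^ 2.
Proof.
  intros H. rewrite nrm_sqr by exact H.
  apply (sum_le_Series (fun k => f k ^ 2)); [intros k; apply pow2_ge_0 | exact H].
Qed.

Lemma L2_bound (f : nat -> R) (M : R) :
  0 <= M -> (forall n, sum_f_R0 (fun k => f k ^ 2) n <= M ^ 2) ->
  L2 f /\ nrm f <= M.
Proof.
  intros HM H.
  destruct (sum_bounded_Series (fun k => f k ^ 2) (M ^ 2)) as [H1 H2]; auto.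
  { intros k. apply pow2_ge_0. }
  split; [exact H1|]. unfold nrm. rewrite <- (sqrt_pow2 M) by exact HM.
  now apply sqrt_le_1_alt.
Qed.

Lemma coord_le_nrm (f : nat -> R) (k : nat) : L2 f -> Rabs (f k) <= nrm f.
Proof.
  intros H. rewrite <- (Rabs_pos_eq (nrm f)) by apply nrm_nonneg.
  apply Rsqr_le_abs_0. rewrite !Rsqr_pow2.
  apply Rle_trans with (2 := sum_le_nrm f k H).
  destruct k as [|k]; cbn [sum_f_R0]; [lra|].
  assert (0 <= sum_f_R0 (fun k => f k ^ 2) k)
    by (apply cond_pos_sum; intros; apply pow2_ge_0).
  lra.
Qed.

Lemma ex_series_mul (f g : nat -> R) :
  L2 f -> L2 g -> ex_series (fun k => f k * g k).
Proof.
  intros Hf Hg.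
  apply (@ex_series_le R_AbsRing R_CompleteNormedModule _
           (fun k => f k ^ 2 + g k ^ 2)).
  - intros k. change (Rabs (f k * g k) <= f k ^ 2 + g k ^ 2).
    apply Rabs_le. pose proof (pow2_ge_0 (f k + g k)).
    pose proof (pow2_ge_0 (f k - g k)). nra.
  - now apply (@ex_series_plus R_AbsRing R_NormedModule).
Qed.

Lemma is_series_lincomb (f g : nat -> R) (a b lf lg : R) :
  is_series f lf -> is_series g lg ->
  is_series (fun k => a * f k + b * g k) (a * lf + b * lg).
Proof.
  intros Hf Hg.
  apply (is_series_plus (fun k => a * f k) (fun k => b * g k)).
  - now apply (is_series_scal a f).
  - now apply (is_series_scal b g).
Qed.

Lemma is_series_sqr_lincomb (f g : nat -> R) (a b : R) :
  L2 f -> L2 g ->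
  is_series (fun k => (a * f k + b * g k) ^ 2)
    (a ^ 2 * nrm f ^ 2 + 2 * a * b * Series (fun k => f k * g k) + b ^ 2 * nrm g ^ 2).
Proof.
  intros Hf Hg. rewrite !nrm_sqr by assumption.
  apply (is_series_ext (fun k => 1 * (a ^ 2 * f k ^ 2 + 2 * a * b * (f k * g k))
                                 + b ^ 2 * g k ^ 2)).
  { intros k. real_eq. ring. }
  replace (a ^ 2 * Series (fun k => f k ^ 2) +
           2 * a * b * Series (fun k => f k * g k) +
           b ^ 2 * Series (fun k => g k ^ 2)) with
    (1 * (a ^ 2 * Series (fun k => f k ^ 2) +
           2 * a * b * Series (fun k => f k * g k)) +
           b ^ 2 * Series (fun k => g k ^ 2)) by ring.
  apply (is_series_lincomb (fun k => a ^ 2 * f k ^ 2 + 2 * a * b * (f k * g k))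
           (fun k => g k ^ 2)).
  - apply (is_series_lincomb (fun k => f k ^ 2) (fun k => f k * g k));
      apply Series_correct; [exact Hf | now apply ex_series_mul].
  - now apply Series_correct.
Qed.

Lemma L2_lincomb (f g : nat -> R) (a b : R) :
  L2 f -> L2 g -> L2 (fun k => a * f k + b * g k).
Proof. intros Hf Hg. eexists. now apply is_series_sqr_lincomb. Qed.

Lemma L2_ext (f g : nat -> R) : (forall k, f k = g k) -> L2 f -> L2 g.
Proof. intros H. apply ex_series_ext. intros k. now rewrite H. Qed.

Lemma nrm_ext (f g : nat -> R) : (forall k, f k = g k) -> nrm f = nrm g.
Proof.
  intros H. unfold nrm. f_equal. apply Series_ext. intros k. now rewrite H.
Qed.

Lemma Cauchy_Schwarz_Series (f g : nat -> R) :
  L2 f -> L2 g -> Rabs (Series (fun k => f k * g k)) <= nrm f * nrm g.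
Proof.
  intros Hf Hg. set (P := Series _).
  assert (Q : forall a b, 0 <= a ^ 2 * nrm f ^ 2 + 2 * a * b * P + b ^ 2 * nrm g ^ 2).
  { intros a b.
    pose proof (is_series_unique _ _ (is_series_sqr_lincomb f g a b Hf Hg)) as E.
    fold P in E. rewrite <- E.
    apply Series_nonneg; [intros; apply pow2_ge_0|].
    eexists. now apply is_series_sqr_lincomb. }
  pose proof (nrm_nonneg f) as Ha. pose proof (nrm_nonneg g) as Hb.
  set (a := nrm f) in *. set (b := nrm g) in *. clearbody a b P. clear Hf Hg f g.
  rewrite <- (Rabs_pos_eq (a * b)) by nra.
  apply Rsqr_le_abs_0. rewrite !Rsqr_pow2, Rpow_mult_distr.
  (* The pair (b^2, -P) turns Q into b^2 (a^2 b^2 - P^2) >= 0, which is empty for b = 0; there other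
     witnesses force P = 0. *)
  destruct (Req_dec b 0) as [->|Hb0].
  - destruct (Req_dec a 0) as [->|Ha0].
    + pose proof (Q 1 (- P)). nra.
    + pose proof (Q (-P) (a ^ 2)). assert (0 < a ^ 2) by nra. nra.
  - pose proof (Q (b ^ 2) (- P)). assert (0 < b ^ 2) by nra.
    assert (0 <= b ^ 2 * (a ^ 2 * b ^ 2 - P ^ 2)) by nra. nra.
Qed.

Lemma nrm_triangle (f g : nat -> R) :
  L2 f -> L2 g -> nrm (fun k => f k + g k) <= nrm f + nrm g.
Proof.
  intros Hf Hg. pose proof (nrm_nonneg f). pose proof (nrm_nonneg g).
  rewrite (nrm_ext _ (fun k => 1 * f k + 1 * g k)) by (intros; ring).
  unfold nrm at 1.
  rewrite (is_series_unique _ _ (is_series_sqr_lincomb f g 1 1 Hf Hg)).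
  rewrite <- (sqrt_pow2 (nrm f + nrm g)) by lra.
  apply sqrt_le_1_alt.
  pose proof (Cauchy_Schwarz_Series f g Hf Hg) as HCS.
  apply Rabs_le_between in HCS. nra.
Qed.

Lemma L2_scal (f : nat -> R) (a : R) : L2 f -> L2 (fun k => a * f k).
Proof.
  intros Hf. apply (L2_ext (fun k => a * f k + 0 * f k)).
  - intros k. ring.
  - now apply L2_lincomb.
Qed.

Lemma nrm_scal (f : nat -> R) (a : R) : nrm (fun k => a * f k) = Rabs a * nrm f.
Proof.
  unfold nrm. rewrite (Series_ext _ (fun k => a ^ 2 * f k ^ 2)) by (intros; ring).
  rewrite Series_scal_l, sqrt_mult_alt by apply pow2_ge_0.
  now rewrite <- Rsqr_pow2, sqrt_Rsqr_abs.
Qed.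

Lemma L2_plus (f g : nat -> R) : L2 f -> L2 g -> L2 (fun k => f k + g k).
Proof.
  intros Hf Hg. apply (L2_ext (fun k => 1 * f k + 1 * g k)).
  - intros k. ring.
  - now apply L2_lincomb.
Qed.

Lemma L2_minus (f g : nat -> R) : L2 f -> L2 g -> L2 (fun k => f k - g k).
Proof.
  intros Hf Hg. apply (L2_ext (fun k => 1 * f k + -1 * g k)).
  - intros k. ring.
  - now apply L2_lincomb.
Qed.

Lemma is_series_finite (a : nat -> R) (n : nat) :
  (forall k, (n < k)%nat -> a k = 0) -> is_series a (sum_f_R0 a n).
Proof.
  intros H. apply is_series_lim.
  apply (is_lim_seq_ext_loc (fun _ => sum_f_R0 a n)); [|apply is_lim_seq_const].
  exists n. intros m Hm. induction Hm as [|m Hm IH]; [reflexivity|].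
  simpl. rewrite (H (S m)) by lia. lra.
Qed.

Lemma nrm_zero : L2 (fun _ => 0) /\ nrm (fun _ => 0) = 0.
Proof.
  assert (H : is_series (fun _ : nat => 0 ^ 2) 0).
  { pose proof (is_series_finite (fun _ => 0 ^ 2) 0) as H.
    replace (sum_f_R0 (fun _ => 0 ^ 2) 0) with 0 in H by (simpl; ring).
    apply H. intros; ring. }
  split; [now exists 0|].
  unfold nrm. rewrite (is_series_unique _ _ H). apply sqrt_0.
Qed.

Lemma is_lim_seq_sum (u : nat -> nat -> R) (l : nat -> R) (n : nat) :
  (forall k, is_lim_seq (fun m => u m k) (l k)) ->
  is_lim_seq (fun m => sum_f_R0 (u m) n) (sum_f_R0 l n).
Proof.
  intros H. induction n as [|n IH]; cbn [sum_f_R0]; [apply H|].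
  now apply is_lim_seq_plus'.
Qed.

Lemma is_lim_seq_sqr (u : nat -> R) (l : R) :
  is_lim_seq u l -> is_lim_seq (fun n => u n ^ 2) (l ^ 2).
Proof.
  intros H. apply (is_lim_seq_ext (fun n => u n * u n)); [intros; ring|].
  replace (l ^ 2) with (l * l) by ring. now apply is_lim_seq_mult'.
Qed.

Lemma l2_complete (u : nat -> nat -> R) :
  (forall n, L2 (u n)) ->
  (forall eps, 0 < eps -> exists N, forall n m, (N <= n)%nat -> (N <= m)%nat ->
     nrm (fun k => u n k - u m k) <= eps) ->
  exists f, L2 f /\ forall eps, 0 < eps -> exists N, forall n, (N <= n)%nat ->
     nrm (fun k => u n k - f k) <= eps.
Proof.
  intros Hu HC.
  assert (Hlim : forall k, ex_finite_lim_seq (fun n => u n k)).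
  { intros k. apply ex_lim_seq_cauchy_corr. intros eps.
    destruct (HC (eps / 2)) as [N HN]; [destruct eps; simpl; lra|].
    exists N. intros n m Hn Hm.
    pose proof (coord_le_nrm (fun k => u n k - u m k) k (L2_minus _ _ (Hu n) (Hu m))).
    specialize (HN n m Hn Hm). destruct eps; simpl in *. lra. }
  set (f := fun k => real (Lim_seq (fun n => u n k))).
  assert (Hf : forall k, is_lim_seq (fun n => u n k) (f k)).
  { intros k. apply Lim_seq_correct', Hlim. }
  assert (Hclose : forall eps, 0 < eps -> exists N, forall n, (N <= n)%nat ->
     L2 (fun k => u n k - f k) /\ nrm (fun k => u n k - f k) <= eps).
  { intros eps Heps. destruct (HC eps Heps) as [N HN]. exists N. intros n Hn.
    apply L2_bound; [lra|]. intros J.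
    (* As in Fatou's lemma: with J coordinates fixed, m tends to infinity inside a finite sum; J is
       released afterwards by [L2_bound]. *)
    apply (is_lim_seq_le_loc (fun m => sum_f_R0 (fun k => (u n k - u m k) ^ 2) J)
      (fun _ => eps ^ 2) (sum_f_R0 (fun k => (u n k - f k) ^ 2) J) (eps ^ 2)).
    - exists N. intros m Hm.
      apply Rle_trans with (1 := sum_le_nrm (fun k => u n k - u m k) J
                                   (L2_minus _ _ (Hu n) (Hu m))).
      apply pow_incr. split; [apply nrm_nonneg | auto].
    - apply (is_lim_seq_sum (fun m k => (u n k - u m k) ^ 2)). intros k.
      apply (is_lim_seq_sqr (fun m => u n k - u m k)).
      apply is_lim_seq_minus'; [apply is_lim_seq_const | apply Hf].
    - apply is_lim_seq_const. }
  exists f. split.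
  - destruct (Hclose 1 Rlt_0_1) as [N HN]. destruct (HN N (le_n N)) as [H _].
    apply (L2_ext (fun k => u N k - (u N k - f k))); [intros; ring|].
    apply L2_minus; auto.
  - intros eps Heps. destruct (Hclose eps Heps) as [N HN]. exists N.
    intros n Hn. now apply HN.
Qed.

(** * Toeplitz operators with bounded symbol *)

Lemma sum_delta (f : nat -> R) (j n : nat) :
  sum_f_R0 (fun k => (if Nat.eq_dec k j then 1 else 0) * f k) n =
  if le_dec j n then f j else 0.
Proof.
  induction n as [|n IH]; cbn [sum_f_R0].
  - destruct (Nat.eq_dec 0 j), (le_dec j 0); subst; try lia; ring.
  - rewrite IH. destruct (Nat.eq_dec (S n) j), (le_dec j n), (le_dec j (S n));
      subst; try lia; ring.
Qed.

(** Parseval for trigonometric polynomials, since g_0 = 1 has the identity matrix. It puts sums of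
    squares under the same integral sign as Toeplitz forms. *)
Lemma bil_id (h f : nat -> R) (n : nat) :
  bil (gcos 0) (gsin 0) h f n = sum_f_R0 (fun j => h j * f j) n.
Proof.
  apply sum_eq. intros j Hj. f_equal.
  rewrite (sum_eq _ (fun k => (if Nat.eq_dec k j then 1 else 0) * f k)).
  - rewrite sum_delta. destruct (le_dec j n); [reflexivity | lia].
  - intros k _. rewrite kern_g.
    replace (0 - (INR j - INR k)) with (INR k - INR j) by ring.
    now rewrite sinc_nat_diff.
Qed.

Lemma gcos_0 (x : R) : gcos 0 x = 1.
Proof. unfold gcos. replace (2 * PI * 0 * x) with 0 by ring. apply cos_0. Qed.

Lemma gsin_0 (x : R) : gsin 0 x = 0.
Proof. unfold gsin. replace (2 * PI * 0 * x) with 0 by ring. apply sin_0. Qed.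

Definition symbol_le (A B : R -> R) (M : R) : Prop :=
  (forall x, continuous A x) /\ (forall x, continuous B x) /\ 0 < M /\
  forall x, -1/2 <= x <= 1/2 -> A x ^ 2 + B x ^ 2 <= M ^ 2.

Lemma symbol_le_g (xi : R) : symbol_le (gcos xi) (gsin xi) 1.
Proof.
  repeat split.
  - intros x. apply continuous_cos_lin.
  - intros x. apply continuous_sin_lin.
  - lra.
  - intros x _. unfold gcos, gsin. pose proof (sin2_cos2 (2 * PI * xi * x)) as H.
    rewrite !Rsqr_pow2 in H. lra.
Qed.

Lemma sum_sqr (f : nat -> R) (n : nat) :
  sum_f_R0 (fun j => f j * f j) n = sum_f_R0 (fun j => f j ^ 2) n.
Proof. apply sum_eq. intros; ring. Qed.

(** With s = A + iB and |s| <= M, expanding |M H - s F|^2 >= 0 bounds the integrand pointwise. The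
    bound by a sum of squares rather than a product of norms integrates directly; suitable choices
    of h recover the norm estimates. *)
Lemma bil_bound (A B : R -> R) (M : R) (h f : nat -> R) (n : nat) :
  symbol_le A B M ->
  2 * bil A B h f n <=
    M * (sum_f_R0 (fun j => h j ^ 2) n + sum_f_R0 (fun j => f j ^ 2) n).
Proof.
  intros (HA & HB & HM & Hle).
  destruct (symbol_le_g 0) as (HA0 & HB0 & _ & _).
  rewrite <- (sum_sqr h), <- (sum_sqr f), <- !bil_id.
  pose proof (is_RInt_bil A B h f n HA HB) as H1.
  pose proof (is_RInt_bil _ _ h h n HA0 HB0) as H2.
  pose proof (is_RInt_bil _ _ f f n HA0 HB0) as H3.
  pose proof (is_RInt_scal _ _ _ 2 _ H1) as H1'.
  pose proof (is_RInt_scal _ _ _ M _ (is_RInt_plus _ _ _ _ _ _ H2 H3)) as H2'.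
  refine (is_RInt_le _ _ _ _ _ _ _ H1' H2' _); [lra|].
  intros x Hx. specialize (Hle x ltac:(lra)).
  unfold scal, plus; simpl; unfold mult; simpl.
  rewrite gcos_0, gsin_0.
  set (hc := tcos h n x). set (hs := tsin h n x).
  set (fc := tcos f n x). set (fs := tsin f n x).
  set (a := A x) in *. set (b := B x) in *. clearbody hc hs fc fs a b.
  apply Rmult_le_reg_l with M; [exact HM|].
  assert (0 <= (M * hc - (a * fc - b * fs)) ^ 2 + (M * hs - (a * fs + b * fc)) ^ 2)
    by (apply Rplus_le_le_0_compat; apply pow2_ge_0).
  assert (0 <= (M ^ 2 - (a ^ 2 + b ^ 2)) * (fc ^ 2 + fs ^ 2)).
  { apply Rmult_le_pos; [lra|]. apply Rplus_le_le_0_compat; apply pow2_ge_0. }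
  nra.
Qed.

(** For h = f the integrand reduces to A |F|^2, so only the real parts of the two symbols have to be
    compared. *)
Lemma bil_mono (A B A' B' : R -> R) (f : nat -> R) (n : nat) :
  (forall x, continuous A x) -> (forall x, continuous B x) ->
  (forall x, continuous A' x) -> (forall x, continuous B' x) ->
  (forall x, -1/2 < x < 1/2 -> A x <= A' x) ->
  bil A B f f n <= bil A' B' f f n.
Proof.
  intros HA HB HA' HB' Hle.
  refine (is_RInt_le _ _ _ _ _ _ _ (is_RInt_bil A B f f n HA HB)
            (is_RInt_bil A' B' f f n HA' HB') _); [lra|].
  intros x Hx. specialize (Hle x Hx).
  assert (0 <= tcos f n x * tcos f n x + tsin f n x * tsin f n x) by nra.
  nra.
Qed.

(** Testing [bil_bound] on h = M e_j and on the row itself gives 2 M S <= M (M^2 + S) for every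
    partial sum S of its squares, that is S <= M^2. *)
Lemma row_L2 (A B : R -> R) (M : R) (j : nat) :
  symbol_le A B M -> L2 (fun k => kern A B (INR j - INR k)).
Proof.
  intros HS. pose proof HS as (_ & _ & HM & _).
  set (r := fun k => kern A B (INR j - INR k)).
  refine (proj1 (L2_bound r M _ _)); [lra|]. intros n.
  (* The section is enlarged until it contains the index j of the test vector. *)
  apply Rle_trans with (sum_f_R0 (fun k => r k ^ 2) (max n j)).
  { apply sum_le_extend; [intros; apply pow2_ge_0 | lia]. }
  set (m := max n j). assert (Hm : (j <= m)%nat) by lia. clearbody m.
  pose proof (bil_bound A B M (fun k => (if Nat.eq_dec k j then 1 else 0) * M) r m HS)
    as H.
  assert (E1 : bil A B (fun k => (if Nat.eq_dec k j then 1 else 0) * M) r m =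
               M * sum_f_R0 (fun k => r k ^ 2) m).
  { unfold bil.
    rewrite (sum_eq _ (fun i => (if Nat.eq_dec i j then 1 else 0) * (M *
       sum_f_R0 (fun k => kern A B (INR i - INR k) * r k) m))) by (intros; ring).
    rewrite (sum_delta (fun i => M *
       sum_f_R0 (fun k => kern A B (INR i - INR k) * r k) m)).
    destruct (le_dec j m); [|lia]. f_equal. apply sum_eq. intros. unfold r. ring. }
  assert (E2 : sum_f_R0 (fun k => ((if Nat.eq_dec k j then 1 else 0) * M) ^ 2) m = M ^ 2).
  { rewrite (sum_eq _ (fun k => (if Nat.eq_dec k j then 1 else 0) * M ^ 2))
      by (intros k _; destruct (Nat.eq_dec k j); ring).
    rewrite (sum_delta (fun _ => M ^ 2)). destruct (le_dec j m); [reflexivity | lia]. }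
  rewrite E1, E2 in H. nra.
Qed.

Definition op (A B : R -> R) (f : nat -> R) (j : nat) : R :=
  Series (fun k => kern A B (INR j - INR k) * f k).

Lemma is_series_op (A B : R -> R) (M : R) (f : nat -> R) (j : nat) :
  symbol_le A B M -> L2 f ->
  is_series (fun k => kern A B (INR j - INR k) * f k) (op A B f j).
Proof.
  intros HS Hf. apply Series_correct.
  apply (ex_series_mul (fun k => kern A B (INR j - INR k))); [|exact Hf].
  now apply row_L2 with M.
Qed.

(** Duality: [bil_bound] is tested on h = y / M, where y is the image of f. With Y and F the sums of
    squares of y and f it reads 2 Y / M <= M (Y / M^2 + F), that is Y <= M^2 F. *)
Lemma section_bound (A B : R -> R) (M : R) (f : nat -> R) (n : nat) :
  symbol_le A B M ->
  sum_f_R0 (fun j => sum_f_R0 (fun k => kern A B (INR j - INR k) * f k) n ^ 2) n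
  <= M ^ 2 * sum_f_R0 (fun k => f k ^ 2) n.
Proof.
  intros HS. pose proof HS as (_ & _ & HM & _).
  set (y := fun j => sum_f_R0 (fun k => kern A B (INR j - INR k) * f k) n).
  pose proof (bil_bound A B M (fun j => y j * / M) f n HS) as H.
  assert (E1 : bil A B (fun j => y j * / M) f n =
               / M * sum_f_R0 (fun j => y j ^ 2) n).
  { rewrite scal_sum. apply sum_eq. intros j _. fold (y j). ring. }
  assert (E2 : sum_f_R0 (fun j => (y j * / M) ^ 2) n =
               / M ^ 2 * sum_f_R0 (fun j => y j ^ 2) n).
  { rewrite scal_sum. apply sum_eq. intros j _. field. lra. }
  rewrite E1, E2 in H.
  set (Y := sum_f_R0 (fun j => y j ^ 2) n) in *.
  set (F := sum_f_R0 (fun k => f k ^ 2) n) in *.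
  change (Y <= M ^ 2 * F). clearbody Y F. clear E1 E2.
  apply (Rmult_le_compat_l M) in H; [|lra].
  replace (M * (2 * (/ M * Y))) with (2 * Y) in H by (field; lra).
  replace (M * (M * (/ M ^ 2 * Y + F))) with (Y + M ^ 2 * F) in H by (field; lra).
  lra.
Qed.

Lemma op_bound (A B : R -> R) (M : R) (f : nat -> R) :
  symbol_le A B M -> L2 f -> L2 (op A B f) /\ nrm (op A B f) <= M * nrm f.
Proof.
  intros HS Hf. pose proof HS as (_ & _ & HM & _).
  apply L2_bound.
  { apply Rmult_le_pos; [lra | apply nrm_nonneg]. }
  intros J.
  (* Keeping only the first J rows of the n-th section, with J fixed, allows n to tend to infinity
     in each row separately. *)
  apply (is_lim_seq_le_loc
    (fun n => sum_f_R0 (fun j =>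
       sum_f_R0 (fun k => kern A B (INR j - INR k) * f k) n ^ 2) J)
    (fun _ => (M * nrm f) ^ 2) (sum_f_R0 (fun j => op A B f j ^ 2) J)
    ((M * nrm f) ^ 2)).
  - exists J. intros n Hn.
    apply Rle_trans with (sum_f_R0 (fun j =>
       sum_f_R0 (fun k => kern A B (INR j - INR k) * f k) n ^ 2) n).
    { apply (sum_le_extend (fun j =>
       sum_f_R0 (fun k => kern A B (INR j - INR k) * f k) n ^ 2));
       [intros; apply pow2_ge_0 | exact Hn]. }
    eapply Rle_trans; [apply (section_bound A B M f n HS)|].
    rewrite Rpow_mult_distr. apply Rmult_le_compat_l; [apply pow2_ge_0|].
    now apply sum_le_nrm.
  - apply (is_lim_seq_sum (fun n j =>
       sum_f_R0 (fun k => kern A B (INR j - INR k) * f k) n ^ 2)).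
    intros j.
    apply (is_lim_seq_sqr (fun n => sum_f_R0 (fun k => kern A B (INR j - INR k) * f k) n)).
    apply is_series_lim. now apply is_series_op with M.
  - apply is_lim_seq_const.
Qed.

Lemma op_lincomb (A B : R -> R) (M a b : R) (f g : nat -> R) (j : nat) :
  symbol_le A B M -> L2 f -> L2 g ->
  op A B (fun k => a * f k + b * g k) j = a * op A B f j + b * op A B g j.
Proof.
  intros HS Hf Hg. apply is_series_unique.
  apply (is_series_ext (fun k => a * (kern A B (INR j - INR k) * f k) +
                                 b * (kern A B (INR j - INR k) * g k))).
  { intros k. real_eq. ring. }
  apply is_series_lincomb; now apply is_series_op with M.
Qed.

Lemma op_minus (A B : R -> R) (M : R) (f g : nat -> R) (j : nat) :
  symbol_le A B M -> L2 f -> L2 g ->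
  op A B (fun k => f k - g k) j = op A B f j - op A B g j.
Proof.
  intros HS Hf Hg.
  replace (op A B f j - op A B g j) with (1 * op A B f j + -1 * op A B g j) by ring.
  rewrite <- (op_lincomb A B M) by assumption.
  apply Series_ext. intros k. ring.
Qed.

Lemma kern_lincomb (A B A' B' : R -> R) (a b d : R) :
  (forall x, continuous A x) -> (forall x, continuous B x) ->
  (forall x, continuous A' x) -> (forall x, continuous B' x) ->
  kern (fun x => a * A x + b * A' x) (fun x => a * B x + b * B' x) d =
  a * kern A B d + b * kern A' B' d.
Proof.
  intros HA HB HA' HB'. apply is_RInt_unique.
  eapply is_RInt_ext; [|apply (is_RInt_plus _ _ _ _ _ _
     (is_RInt_scal _ _ _ a _ (is_RInt_kern A B d HA HB))
     (is_RInt_scal _ _ _ b _ (is_RInt_kern A' B' d HA' HB')))].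
  intros x _. real_eq. unfold scal, plus; simpl; unfold mult; simpl. ring.
Qed.

Lemma op_symbol_lincomb (A B A' B' : R -> R) (M M' a b : R) (f : nat -> R) (j : nat) :
  symbol_le A B M -> symbol_le A' B' M' -> L2 f ->
  op (fun x => a * A x + b * A' x) (fun x => a * B x + b * B' x) f j =
  a * op A B f j + b * op A' B' f j.
Proof.
  intros HS HS' Hf. apply is_series_unique.
  apply (is_series_ext (fun k => a * (kern A B (INR j - INR k) * f k) +
                                 b * (kern A' B' (INR j - INR k) * f k))).
  { intros k. real_eq.
    destruct HS as (? & ? & _), HS' as (? & ? & _).
    rewrite kern_lincomb by assumption. ring. }
  apply is_series_lincomb; [now apply is_series_op with M | now apply is_series_op with M'].
Qed.

Lemma op_id (f : nat -> R) (j : nat) : op (gcos 0) (gsin 0) f j = f j.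
Proof.
  apply is_series_unique.
  apply (is_series_ext (fun k => (if Nat.eq_dec k j then 1 else 0) * f k)).
  { intros k. real_eq. rewrite kern_g.
    replace (0 - (INR j - INR k)) with (INR k - INR j) by ring.
    now rewrite sinc_nat_diff. }
  pose proof (is_series_finite (fun k => (if Nat.eq_dec k j then 1 else 0) * f k) j) as H.
  rewrite sum_delta in H. destruct (le_dec j j); [|lia]. apply H.
  intros k Hk. destruct (Nat.eq_dec k j); [lia | ring].
Qed.

Definition toep (xi : R) : (nat -> R) -> nat -> R := op (gcos xi) (gsin xi).

Lemma is_series_toep (xi : R) (f : nat -> R) (j : nat) :
  L2 f -> is_series (fun k => sinc (xi - (INR j - INR k)) * f k) (toep xi f j).
Proof.
  intros Hf.
  apply (is_series_ext (fun k => kern (gcos xi) (gsin xi) (INR j - INR k) * f k)).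
  { intros k. now rewrite kern_g. }
  apply is_series_op with 1; [apply symbol_le_g | exact Hf].
Qed.

(** * The range -1/2 <= xi < 1/2 and integer shifts of the symbol *)

Lemma cos_PI_pos (xi : R) : -1/2 < xi < 1/2 -> 0 < cos (PI * xi) <= 1.
Proof.
  intros H. pose proof PI_RGT_0. split; [|apply COS_bound].
  apply cos_gt_0; nra.
Qed.

Lemma gcos_ge (xi x : R) :
  -1/2 < xi < 1/2 -> -1/2 <= x <= 1/2 -> cos (PI * xi) <= gcos xi x.
Proof.
  intros Hxi Hx. pose proof PI_RGT_0 as HPI. unfold gcos.
  assert (E : forall y, cos y = cos (Rabs y)).
  { intros y. unfold Rabs. destruct (Rcase_abs y); [now rewrite cos_neg | reflexivity]. }
  rewrite (E (PI * xi)), (E (2 * PI * xi * x)).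
  assert (HR : Rabs (2 * PI * xi * x) <= Rabs (PI * xi)).
  { replace (2 * PI * xi * x) with (PI * xi * (2 * x)) by ring.
    rewrite (Rabs_mult (PI * xi) (2 * x)).
    assert (Rabs (2 * x) <= 1) by (apply Rabs_le; lra).
    pose proof (Rabs_pos (PI * xi)). nra. }
  assert (Rabs (PI * xi) <= PI) by (apply Rabs_le; nra).
  apply cos_decr_1; try apply Rabs_pos; lra.
Qed.

(** Together with [neu_B] this is the symbol 1 - t g_xi of I - t T_xi, in the shape that
    [op_symbol_lincomb] expects. *)
Definition neu_A (t xi x : R) : R := 1 * gcos 0 x + - t * gcos xi x.
Definition neu_B (t xi x : R) : R := 1 * gsin 0 x + - t * gsin xi x.

Lemma continuous_lincomb (A B : R -> R) (a b x : R) :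
  continuous A x -> continuous B x -> continuous (fun x => a * A x + b * B x) x.
Proof.
  intros HA HB.
  apply (continuous_plus (fun x => a * A x) (fun x => b * B x)).
  - apply (continuous_mult (fun _ => a) A); [apply continuous_const | exact HA].
  - apply (continuous_mult (fun _ => b) B); [apply continuous_const | exact HB].
Qed.

(* |1 - t e^{i s}|^2 = 1 - 2 t cos s + t^2, and cos s >= c := cos (PI xi) on the
   range of the phase; t = c / 2 keeps the bound strictly positive. *)
Lemma symbol_le_neumann (xi : R) :
  -1/2 < xi < 1/2 ->
  symbol_le (neu_A (cos (PI * xi) / 2) xi) (neu_B (cos (PI * xi) / 2) xi)
    (sqrt (1 - 3 / 4 * cos (PI * xi) ^ 2)).
Proof.
  intros Hxi. pose proof (cos_PI_pos xi Hxi) as Hc.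
  destruct (symbol_le_g 0) as (HA0 & HB0 & _). destruct (symbol_le_g xi) as (HA & HB & _).
  repeat split.
  - intros x. now apply (continuous_lincomb (gcos 0) (gcos xi)).
  - intros x. now apply (continuous_lincomb (gsin 0) (gsin xi)).
  - apply sqrt_lt_R0. nra.
  - intros x Hx. rewrite <- (Rsqr_pow2 (sqrt _)), Rsqr_sqrt by nra.
    unfold neu_A, neu_B. rewrite gcos_0, gsin_0.
    pose proof (gcos_ge xi x Hxi Hx) as Hge.
    assert (H1 : gcos xi x ^ 2 + gsin xi x ^ 2 = 1).
    { unfold gcos, gsin. rewrite <- !Rsqr_pow2, Rplus_comm. apply sin2_cos2. }
    set (c := cos (PI * xi)) in *. set (p := gcos xi x) in *.
    set (q := gsin xi x) in *. clearbody c p q.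
    assert (E : (1 * 1 + - (c / 2) * p) ^ 2 + (1 * 0 + - (c / 2) * q) ^ 2 =
                1 - c * p + c ^ 2 / 4 * (p ^ 2 + q ^ 2)) by field.
    rewrite E, H1. nra.
Qed.

(** For t = c / 2 the worst case cos s = c gives 1 - 2 t c + t^2 = 1 - 3/4 c^2, and 0 < c <= 1 puts
    this strictly between 0 and 1. *)
Lemma neumann_rate (xi : R) :
  -1/2 < xi < 1/2 -> 0 < sqrt (1 - 3 / 4 * cos (PI * xi) ^ 2) < 1.
Proof.
  intros Hxi. pose proof (cos_PI_pos xi Hxi) as Hc. split.
  - apply sqrt_lt_R0. nra.
  - rewrite <- sqrt_1 at 2. apply sqrt_lt_1_alt. nra.
Qed.

Lemma op_neumann (t xi : R) (f : nat -> R) (j : nat) :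
  L2 f -> op (neu_A t xi) (neu_B t xi) f j = f j - t * toep xi f j.
Proof.
  intros Hf. unfold neu_A, neu_B.
  rewrite (op_symbol_lincomb (gcos 0) (gsin 0) (gcos xi) (gsin xi) 1 1)
    by (try apply symbol_le_g; exact Hf).
  rewrite op_id. unfold toep. ring.
Qed.

Lemma toep_bound (xi : R) (f : nat -> R) :
  L2 f -> L2 (toep xi f) /\ nrm (toep xi f) <= nrm f.
Proof.
  intros Hf.
  destruct (op_bound (gcos xi) (gsin xi) 1 f (symbol_le_g xi) Hf) as [H1 H2].
  rewrite Rmult_1_l in H2. now split.
Qed.

(** Splitting f = (f - t T f) + t T f, with the first part of norm at most r |f|, yields (1 - r) |f|
    <= t |T f|. *)
Lemma toep_bounded_below (xi : R) :
  -1/2 < xi < 1/2 ->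
  exists c, 0 < c /\ forall f, L2 f -> c * nrm f <= nrm (toep xi f).
Proof.
  intros Hxi. pose proof (cos_PI_pos xi Hxi) as Hc.
  pose proof (symbol_le_neumann xi Hxi) as HS. pose proof (neumann_rate xi Hxi) as Hr.
  set (r := sqrt _) in *. set (t := cos (PI * xi) / 2) in *.
  assert (Ht : 0 < t) by (unfold t; lra). clearbody r t.
  exists ((1 - r) / t). split; [apply Rdiv_lt_0_compat; lra|].
  intros f Hf. destruct (op_bound _ _ _ f HS Hf) as [H1 H2].
  destruct (toep_bound xi f Hf) as [H3 _].
  assert (H : nrm f <= r * nrm f + t * nrm (toep xi f)).
  { rewrite (nrm_ext f (fun k => op (neu_A t xi) (neu_B t xi) f k + t * toep xi f k))
      at 1 by (intros k; rewrite op_neumann by exact Hf; ring).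
    eapply Rle_trans; [apply nrm_triangle; [exact H1 | now apply L2_scal]|].
    rewrite nrm_scal, (Rabs_pos_eq t) by lra. lra. }
  apply Rmult_le_reg_l with t; [exact Ht|].
  replace (t * ((1 - r) / t * nrm f)) with ((1 - r) * nrm f) by (field; lra). lra.
Qed.

Lemma nrm_minus_sym (f g : nat -> R) :
  nrm (fun k => f k - g k) = nrm (fun k => g k - f k).
Proof.
  rewrite (nrm_ext (fun k => g k - f k) (fun k => -1 * (f k - g k))) by (intros; ring).
  rewrite (nrm_scal (fun k => f k - g k)), Rabs_left by lra. ring.
Qed.

Fixpoint neumann_iter (A B : R -> R) (h : nat -> R) (n : nat) : nat -> R :=
  match n with
  | O => fun _ => 0
  | S m => fun k => op A B (neumann_iter A B h m) k + h k
  end.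

Lemma contraction_fixpoint (A B : R -> R) (r : R) (h : nat -> R) :
  symbol_le A B r -> r < 1 -> L2 h ->
  exists f, L2 f /\ forall j, f j = op A B f j + h j.
Proof.
  intros HS Hr Hh. pose proof HS as (_ & _ & Hr0 & _).
  set (u := neumann_iter A B h).
  assert (u0 : forall k, u 0%nat k = 0) by reflexivity.
  assert (uS : forall n k, u (S n) k = op A B (u n) k + h k) by reflexivity.
  (* D is the sum of the geometric series with ratio r started at the norm of h, hence a bound for
     all iterates. *)
  set (D := nrm h / (1 - r)).
  assert (HD : r * D + nrm h = D) by (unfold D; field; lra).
  assert (HD0 : 0 <= D).
  { unfold D. apply Rmult_le_pos; [apply nrm_nonneg|].
    apply Rlt_le, Rinv_0_lt_compat. lra. }
  assert (Hu : forall n, L2 (u n) /\ nrm (u n) <= D).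
  { induction n as [|n [IH1 IH2]]; cbn [u neumann_iter].
    - destruct nrm_zero as [H ->]. auto.
    - change (neumann_iter A B h n) with (u n). destruct (op_bound A B r (u n) HS IH1) as [H1 H2].
      split; [now apply L2_plus|].
      eapply Rle_trans; [now apply nrm_triangle|].
      assert (r * nrm (u n) <= r * D) by (apply Rmult_le_compat_l; lra). lra. }
  (* Writing the larger index as m + n lets induction on n peel one application of the operator off
     both iterates, down to u m - u 0 = u m. *)
  assert (Hdist : forall m n, nrm (fun k => u (m + n)%nat k - u n k) <= r ^ n * D).
  { intros m n. induction n as [|n IH].
    - rewrite Nat.add_0_r, Rmult_1_l.
      rewrite (nrm_ext _ (u m)) by (intros; rewrite u0; ring). apply Hu.
    - rewrite Nat.add_succ_r.
      rewrite (nrm_ext _ (op A B (fun k => u (m + n)%nat k - u n k))).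
      2: { intros k. rewrite (op_minus A B r) by (auto; apply Hu). rewrite !uS. ring. }
      eapply Rle_trans; [apply (op_bound A B r); [exact HS|apply L2_minus; apply Hu]|].
      simpl. rewrite Rmult_assoc. apply Rmult_le_compat_l; lra. }
  assert (Hsmall : forall eps, 0 < eps -> exists N, r ^ N * D <= eps).
  { intros eps Heps.
    assert (HL : is_lim_seq (fun n => r ^ n * D) 0).
    { replace 0 with (0 * D) by ring.
      apply is_lim_seq_mult'; [|apply is_lim_seq_const].
      apply is_lim_seq_geom. rewrite Rabs_pos_eq; lra. }
    apply is_lim_seq_spec in HL. destruct (HL (mkposreal eps Heps)) as [N HN].
    exists N. specialize (HN N (le_n N)). simpl in HN. rewrite Rminus_0_r in HN.
    apply Rabs_lt_between in HN. lra. }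
  destruct (l2_complete u) as (f & Hf & Hcv).
  { intros n. apply Hu. }
  { intros eps Heps. destruct (Hsmall (eps / 2)) as [N HN]; [lra|].
    exists N. intros n m Hn Hm.
    rewrite (nrm_ext _ (fun k => (u n k - u N k) + (u N k - u m k))) by (intros; ring).
    eapply Rle_trans; [apply (nrm_triangle (fun k => u n k - u N k)
       (fun k => u N k - u m k)); apply L2_minus; apply Hu|].
    rewrite (nrm_minus_sym (u N)).
    pose proof (Hdist (n - N)%nat N) as H1. pose proof (Hdist (m - N)%nat N) as H2.
    rewrite Nat.sub_add in H1, H2 by assumption. lra. }
  exists f. split; [exact Hf|]. intros j.
  (* The fixed-point equation is checked coordinatewise up to eps, comparing f with u (S N) on the
     left and with u N under the operator. *)
  apply Rminus_diag_uniq, Rabs_eq_0, Rle_antisym; [|apply Rabs_pos].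
  apply le_epsilon. intros eps Heps. rewrite Rplus_0_l.
  destruct (Hcv (eps / 2)) as [N HN]; [lra|].
  pose proof (HN N (le_n N)) as H1. pose proof (HN (S N) (le_S _ _ (le_n N))) as H2.
  assert (L1 : L2 (fun k => u N k - f k)) by (apply L2_minus; [apply Hu | exact Hf]).
  assert (L2' : L2 (fun k => u (S N) k - f k)) by (apply L2_minus; [apply Hu | exact Hf]).
  pose proof (coord_le_nrm _ j L2') as H3.
  destruct (op_bound A B r _ HS L1) as [H4 H5].
  pose proof (coord_le_nrm _ j H4) as H6.
  rewrite (op_minus A B r) in H6 by (auto; apply Hu).
  replace (f j - (op A B f j + h j)) with
    (- (u (S N) j - f j) + (op A B (u N) j - op A B f j)) by (rewrite uS; ring).
  eapply Rle_trans; [apply Rabs_triang|]. rewrite Rabs_Ropp.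
  pose proof (nrm_nonneg (fun k => u N k - f k)).
  cbv beta in *. nra.
Qed.

Lemma toep_surjective (xi : R) (h : nat -> R) :
  -1/2 < xi < 1/2 -> L2 h -> exists f, L2 f /\ forall j, toep xi f j = h j.
Proof.
  intros Hxi Hh. pose proof (cos_PI_pos xi Hxi) as Hc.
  pose proof (symbol_le_neumann xi Hxi) as HS. pose proof (neumann_rate xi Hxi) as Hr.
  set (t := cos (PI * xi) / 2) in *.
  assert (Ht : 0 < t) by (unfold t; lra). clearbody t.
  (* A fixed point of f = (f - t T f) + t h satisfies t T f = t h. *)
  destruct (contraction_fixpoint _ _ _ (fun k => t * h k) HS) as (f & Hf & E);
    [lra | now apply L2_scal |].
  exists f. split; [exact Hf|]. intros j. specialize (E j).
  rewrite op_neumann in E by exact Hf.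
  apply Rmult_eq_reg_l with t; lra.
Qed.

Lemma nrm_eq_0 (f : nat -> R) (k : nat) : L2 f -> nrm f <= 0 -> f k = 0.
Proof.
  intros Hf H. pose proof (coord_le_nrm f k Hf). pose proof (Rabs_pos (f k)).
  apply Rabs_eq_0. lra.
Qed.

Lemma toep_injective (xi : R) (f : nat -> R) :
  -1/2 < xi < 1/2 -> L2 f -> (forall j, toep xi f j = 0) -> forall k, f k = 0.
Proof.
  intros Hxi Hf H k. destruct (toep_bounded_below xi Hxi) as (c & Hc & HB).
  specialize (HB f Hf). rewrite (nrm_ext (toep xi f) (fun _ => 0)) in HB by exact H.
  rewrite (proj2 nrm_zero) in HB. apply nrm_eq_0; [exact Hf|]. nra.
Qed.

(** * Truncations and injectivity at the endpoint xi = -1/2 *)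

Definition trunc (n : nat) (f : nat -> R) (k : nat) : R :=
  if le_dec k n then f k else 0.

Lemma is_series_trunc (n : nat) (f a : nat -> R) :
  is_series (fun k => a k * trunc n f k) (sum_f_R0 (fun k => a k * f k) n).
Proof.
  rewrite (sum_eq _ (fun k => a k * trunc n f k)).
  - apply is_series_finite. intros k Hk. unfold trunc.
    destruct (le_dec k n); [lia | ring].
  - intros k Hk. unfold trunc. destruct (le_dec k n); [reflexivity | lia].
Qed.

Lemma is_series_trunc_sqr (n : nat) (f : nat -> R) :
  is_series (fun k => trunc n f k ^ 2) (sum_f_R0 (fun k => f k ^ 2) n).
Proof.
  apply (is_series_ext (fun k => f k * trunc n f k)).
  - intros k. real_eq. unfold trunc. destruct (le_dec k n); ring.
  - rewrite <- sum_sqr. apply is_series_trunc.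
Qed.

Lemma L2_trunc (n : nat) (f : nat -> R) : L2 (trunc n f).
Proof. eexists. apply is_series_trunc_sqr. Qed.

Lemma nrm_trunc_sqr (n : nat) (f : nat -> R) :
  nrm (trunc n f) ^ 2 = sum_f_R0 (fun k => f k ^ 2) n.
Proof.
  rewrite nrm_sqr by apply L2_trunc. apply is_series_unique, is_series_trunc_sqr.
Qed.

Lemma nrm_trunc_le (n : nat) (f : nat -> R) : L2 f -> nrm (trunc n f) <= nrm f.
Proof.
  intros Hf. apply Rsqr_incr_0; try apply nrm_nonneg.
  rewrite !Rsqr_pow2, nrm_trunc_sqr. now apply sum_le_nrm.
Qed.

Lemma nrm_tail (f : nat -> R) :
  L2 f -> is_lim_seq (fun n => nrm (fun k => f k - trunc n f k)) 0.
Proof.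
  intros Hf.
  apply (is_lim_seq_ext (fun n => sqrt (Series (fun k => f k ^ 2) -
                                        sum_f_R0 (fun k => f k ^ 2) n))).
  - intros n. unfold nrm. f_equal. symmetry. apply is_series_unique.
    apply (is_series_ext (fun k => 1 * f k ^ 2 + -1 * trunc n f k ^ 2)).
    + intros k. real_eq. unfold trunc. destruct (le_dec k n); ring.
    + replace (Series (fun k => f k ^ 2) - sum_f_R0 (fun k => f k ^ 2) n) with
        (1 * Series (fun k => f k ^ 2) + -1 * sum_f_R0 (fun k => f k ^ 2) n) by ring.
      apply (is_series_lincomb (fun k => f k ^ 2) (fun k => trunc n f k ^ 2)).
      * now apply Series_correct.
      * apply is_series_trunc_sqr.
  - rewrite <- sqrt_0.
    apply (is_lim_seq_continuous sqrt); [apply continuity_pt_sqrt; lra|].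
    rewrite <- (Rminus_diag (Series (fun k => f k ^ 2))).
    apply is_lim_seq_minus'; [apply is_lim_seq_const|].
    now apply (Series_lim (fun k => f k ^ 2)).
Qed.

(** Coefficients of z f(z). The 0 at index 0 stands for f_{-1}; it starts the induction that ends
    [toep_half_injective]. *)
Definition pred_seq (f : nat -> R) (j : nat) : R :=
  match j with O => 0 | S i => f i end.

Lemma bil_shift (f : nat -> R) (n : nat) :
  bil (gcos 1) (gsin 1) f f n = sum_f_R0 (fun j => f j * pred_seq f j) n.
Proof.
  apply sum_eq. intros j Hj. f_equal.
  rewrite (sum_eq _ (fun k => (if Nat.eq_dec (S k) j then 1 else 0) * f k)).
  - destruct j as [|i]; simpl pred_seq.
    + rewrite (sum_eq _ (fun _ => 0)); [rewrite sum_cte; ring | intros; simpl; ring].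
    + rewrite (sum_eq _ (fun k => (if Nat.eq_dec k i then 1 else 0) * f k)).
      * rewrite sum_delta. destruct (le_dec i n); [reflexivity | lia].
      * intros k _. destruct (Nat.eq_dec (S k) (S i)), (Nat.eq_dec k i);
          try reflexivity; lia.
  - intros k _. rewrite kern_g.
    replace (1 - (INR j - INR k)) with (INR (S k) - INR j) by (rewrite S_INR; ring).
    now rewrite sinc_nat_diff.
Qed.

Lemma bil_symbol_lincomb (A B A' B' : R -> R) (a b : R) (h f : nat -> R) (n : nat) :
  (forall x, continuous A x) -> (forall x, continuous B x) ->
  (forall x, continuous A' x) -> (forall x, continuous B' x) ->
  bil (fun x => a * A x + b * A' x) (fun x => a * B x + b * B' x) h f n =
  a * bil A B h f n + b * bil A' B' h f n.
Proof.
  intros HA HB HA' HB'. unfold bil. rewrite !scal_sum, <- sum_plus.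
  apply sum_eq. intros j _.
  set (p := sum_f_R0 (fun k => kern A B (INR j - INR k) * f k) n).
  set (q := sum_f_R0 (fun k => kern A' B' (INR j - INR k) * f k) n).
  replace (h j * p * a + h j * q * b) with (h j * (a * p + b * q)) by ring.
  f_equal. unfold p, q. rewrite !scal_sum, <- sum_plus. apply sum_eq. intros k _.
  rewrite kern_lincomb by assumption. ring.
Qed.

(** Both sides are the squared norm of (1 + z) times the polynomial with coefficients f_0, ..., f_n;
    the isolated [f n ^ 2] comes from its coefficient of degree n + 1. *)
Lemma sum_sqr_consecutive (f : nat -> R) (n : nat) :
  2 * sum_f_R0 (fun j => f j * f j) n + 2 * sum_f_R0 (fun j => f j * pred_seq f j) n =
  sum_f_R0 (fun j => (f j + pred_seq f j) ^ 2) n + f n ^ 2.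
Proof.
  induction n as [|n IH]; cbn [sum_f_R0 pred_seq]; [ring|].
  rewrite !Rmult_plus_distr_l.
  transitivity ((2 * sum_f_R0 (fun j => f j * f j) n +
                 2 * sum_f_R0 (fun j => f j * pred_seq f j) n) +
     2 * (f (S n) * f (S n)) + 2 * (f (S n) * f n)); [ring|].
  rewrite IH. ring.
Qed.

(* cos (PI x) >= cos (PI x)^2 = (1 + cos (2 PI x)) / 2 and the right-hand side is the
   real part of the symbol (1 + g_1) / 2. *)
Lemma bil_half_lower (f : nat -> R) (n : nat) :
  sum_f_R0 (fun j => (f j + pred_seq f j) ^ 2) n
    <= 4 * bil (gcos (-1/2)) (gsin (-1/2)) f f n.
Proof.
  destruct (symbol_le_g 0) as (HA0 & HB0 & _).
  destruct (symbol_le_g 1) as (HA1 & HB1 & _).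
  destruct (symbol_le_g (-1/2)) as (HA & HB & _).
  assert (H : bil (fun x => 1/2 * gcos 0 x + 1/2 * gcos 1 x)
                (fun x => 1/2 * gsin 0 x + 1/2 * gsin 1 x) f f n
              <= bil (gcos (-1/2)) (gsin (-1/2)) f f n).
  { apply bil_mono; try assumption.
    - intros x. now apply (continuous_lincomb (gcos 0) (gcos 1)).
    - intros x. now apply (continuous_lincomb (gsin 0) (gsin 1)).
    - intros x Hx. rewrite gcos_0. unfold gcos. pose proof PI_RGT_0 as HPI.
      replace (2 * PI * 1 * x) with (2 * (PI * x)) by ring.
      replace (2 * PI * (-1/2) * x) with (- (PI * x)) by field.
      rewrite cos_neg, cos_2a_cos. pose proof (COS_bound (PI * x)).
      assert (0 < cos (PI * x)) by (apply cos_gt_0; nra). nra. }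
  rewrite bil_symbol_lincomb, bil_id, bil_shift in H by assumption.
  pose proof (sum_sqr_consecutive f n). pose proof (pow2_ge_0 (f n)). lra.
Qed.

(** For a truncation t_n of f, T f = 0 gives T t_n = - T (f - t_n). So the form at t_n is at most
    |f| |f - t_n|, which tends to 0, while [bil_half_lower] bounds it below by the squares of the
    f_k + f_{k-1}. *)
Lemma toep_half_injective (f : nat -> R) :
  L2 f -> (forall j, toep (-1/2) f j = 0) -> forall k, f k = 0.
Proof.
  intros Hf HT.
  assert (HB : forall n, bil (gcos (-1/2)) (gsin (-1/2)) f f n
                         <= nrm f * nrm (fun k => f k - trunc n f k)).
  { intros n. set (tn := trunc n f).
    assert (Htn : L2 tn) by apply L2_trunc.
    assert (Hd : L2 (fun k => f k - tn k)) by now apply L2_minus.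
    destruct (toep_bound (-1/2) tn Htn) as [HTn _].
    destruct (toep_bound (-1/2) _ Hd) as [_ HTd].
    assert (E : bil (gcos (-1/2)) (gsin (-1/2)) f f n =
                Series (fun k => tn k * toep (-1/2) tn k)).
    { symmetry. apply is_series_unique.
      apply (is_series_ext (fun k => toep (-1/2) tn k * tn k)).
      { intros k. apply Rmult_comm. }
      unfold bil.
      rewrite (sum_eq _ (fun j => toep (-1/2) tn j * f j)).
      - apply is_series_trunc.
      - intros j _. rewrite Rmult_comm. f_equal. symmetry.
        apply is_series_unique, is_series_trunc. }
    rewrite E. eapply Rle_trans; [apply Rle_abs|].
    eapply Rle_trans; [now apply Cauchy_Schwarz_Series|].
    apply Rmult_le_compat; try apply nrm_nonneg.
    - now apply nrm_trunc_le.
    - eapply Rle_trans; [|exact HTd].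
      rewrite (nrm_ext (toep (-1/2) (fun k => f k - tn k))
                 (fun k => -1 * toep (-1/2) tn k)).
      + rewrite nrm_scal, Rabs_left by lra. lra.
      + intros k. unfold toep. rewrite (op_minus _ _ 1) by (auto; apply symbol_le_g).
        fold (toep (-1/2)). rewrite HT. ring. }
  assert (Hg : forall k, f k + pred_seq f k = 0).
  { intros k.
    assert (H : (f k + pred_seq f k) ^ 2 <= 0).
    { apply (is_lim_seq_le_loc (fun _ => (f k + pred_seq f k) ^ 2)
        (fun n => 4 * (nrm f * nrm (fun k => f k - trunc n f k)))
        ((f k + pred_seq f k) ^ 2) 0).
      - exists k. intros n Hn. specialize (HB n).
        pose proof (bil_half_lower f n) as HL.
        assert ((f k + pred_seq f k) ^ 2 <= sum_f_R0 (fun j => (f j + pred_seq f j) ^ 2) n).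
        { apply Rle_trans with (sum_f_R0 (fun j => (f j + pred_seq f j) ^ 2) k).
          - destruct k as [|k]; cbn [sum_f_R0]; [lra|].
            assert (0 <= sum_f_R0 (fun j => (f j + pred_seq f j) ^ 2) k)
              by (apply cond_pos_sum; intros; apply pow2_ge_0). lra.
          - apply sum_le_extend; [intros; apply pow2_ge_0 | exact Hn]. }
        lra.
      - apply is_lim_seq_const.
      - replace 0 with (4 * (nrm f * 0)) by ring.
        apply is_lim_seq_mult'; [apply is_lim_seq_const|].
        apply is_lim_seq_mult'; [apply is_lim_seq_const|].
        now apply nrm_tail. }
    nra. }
  intros k. induction k as [|k IH].
  - specialize (Hg 0%nat). simpl in Hg. lra.
  - specialize (Hg (S k)). simpl in Hg. lra.
Qed.

(** * The unilateral shift *)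

Definition shift (n : nat) (f : nat -> R) (k : nat) : R :=
  if lt_dec k n then 0 else f (k - n)%nat.

Lemma is_series_drop_zeros (n : nat) (a : nat -> R) (l : R) :
  (forall k, (k < n)%nat -> a k = 0) ->
  is_series (fun k => a (n + k)%nat) l -> is_series a l.
Proof.
  revert a. induction n as [|n IH]; intros a H Hs; [exact Hs|].
  apply (is_series_decr_1 a).
  match goal with |- is_series _ ?x => replace x with l end.
  - apply (IH (fun k => a (S k))).
    + intros k Hk. apply H. lia.
    + exact Hs.
  - real_eq. rewrite H by lia. unfold plus, opp; simpl. ring.
Qed.

Lemma is_series_shift (n : nat) (a b f : nat -> R) (l : R) :
  (forall k, b (n + k)%nat = a k) ->
  is_series (fun k => a k * f k) l -> is_series (fun k => b k * shift n f k) l.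
Proof.
  intros Hab Hs. apply (is_series_drop_zeros n).
  - intros k Hk. unfold shift. destruct (lt_dec k n); [ring | lia].
  - apply (is_series_ext (fun k => a k * f k)); [|exact Hs].
    intros k. unfold shift. destruct (lt_dec (n + k) n); [lia|].
    rewrite Hab. now replace (n + k - n)%nat with k by lia.
Qed.

Lemma is_series_shift_sqr (n : nat) (f : nat -> R) :
  L2 f -> is_series (fun k => shift n f k ^ 2) (Series (fun k => f k ^ 2)).
Proof.
  intros Hf. apply (is_series_drop_zeros n).
  - intros k Hk. unfold shift. destruct (lt_dec k n); [ring | lia].
  - apply (is_series_ext (fun k => f k ^ 2)); [|now apply Series_correct].
    intros k. unfold shift. destruct (lt_dec (n + k) n); [lia|].
    now replace (n + k - n)%nat with k by lia.
Qed.

Lemma nrm_shift (n : nat) (f : nat -> R) :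
  L2 f -> L2 (shift n f) /\ nrm (shift n f) = nrm f.
Proof.
  intros Hf. pose proof (is_series_shift_sqr n f Hf) as H. split.
  - eexists. exact H.
  - unfold nrm. f_equal. now apply is_series_unique.
Qed.

(** The entry in row j and column k depends on xi + k only once j is fixed, so adding n to xi means
    reading column n + k. *)
Lemma toep_shift (xi : R) (n : nat) (f : nat -> R) (j : nat) :
  L2 f -> toep (xi + INR n) f j = toep xi (shift n f) j.
Proof.
  intros Hf. destruct (nrm_shift n f Hf) as [Hs _].
  rewrite <- (is_series_unique _ _ (is_series_toep xi (shift n f) j Hs)).
  symmetry. apply is_series_unique.
  apply (is_series_shift n (fun k => sinc (xi + INR n - (INR j - INR k))));
    [|now apply is_series_toep].
  intros k. f_equal. rewrite plus_INR. ring.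
Qed.

(** * Kernel vectors for xi < -1/2 *)

(* (xi+1)(xi+2)...(xi+k) / k!, so that [kerf] lists the coefficients of (1+z)^{-xi-1}. *)
Fixpoint binco (xi : R) (k : nat) : R :=
  match k with
  | O => 1
  | S m => binco xi m * ((INR m + 1 + xi) / (INR m + 1))
  end.

Definition kerf (xi : R) (k : nat) : R := (-1) ^ k * binco xi k.

Lemma INR_succ_pos (k : nat) : 0 < INR k + 1.
Proof. pose proof (pos_INR k). lra. Qed.

Lemma sqr_sign (k : nat) : ((-1) ^ k) ^ 2 = 1.
Proof. rewrite <- pow_mult, Nat.mul_comm, pow_1_even. reflexivity. Qed.

Lemma kerf_sqr (xi : R) (k : nat) : kerf xi k ^ 2 = binco xi k ^ 2.
Proof. unfold kerf. rewrite Rpow_mult_distr, sqr_sign. ring. Qed.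

(* Raabe: k b_k^2 - (k+1) b_{k+1}^2 = (-1 - 2 xi - xi^2/(k+1)) b_k^2. *)
Lemma binco_L2 (xi : R) : xi < -1/2 -> L2 (binco xi).
Proof.
  intros Hxi. set (c := (-1 - 2 * xi) / 2). assert (Hc : 0 < c) by (unfold c; lra).
  destruct (INR_unbounded (xi ^ 2 / c)) as [K HK].
  assert (HK' : forall k, (K <= k)%nat ->
    c * binco xi k ^ 2 <= INR k * binco xi k ^ 2 - (INR k + 1) * binco xi (S k) ^ 2).
  { intros k Hk. pose proof (INR_succ_pos k) as Hp.
    assert (Hck : xi ^ 2 / (INR k + 1) <= c).
    { apply le_INR in Hk. apply Rle_div_l; [lra|].
      apply Rlt_div_l in HK; [|lra]. nra. }
    cbn [binco].
    replace (INR k * binco xi k ^ 2 -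
      (INR k + 1) * (binco xi k * ((INR k + 1 + xi) / (INR k + 1))) ^ 2) with
      ((2 * c - xi ^ 2 / (INR k + 1)) * binco xi k ^ 2)
      by (unfold c; field; lra).
    apply Rmult_le_compat_r; [apply pow2_ge_0 | lra]. }
  assert (Hsum : forall n, c * sum_f_R0 (fun k => binco xi (K + k) ^ 2) n <=
    INR K * binco xi K ^ 2 - (INR (K + n) + 1) * binco xi (S (K + n)) ^ 2).
  { induction n as [|n IH]; cbn [sum_f_R0].
    - rewrite Nat.add_0_r. apply HK'. lia.
    - specialize (HK' (K + S n)%nat ltac:(lia)).
      rewrite Nat.add_succ_r, S_INR in *. lra. }
  apply (ex_series_incr_n (fun k => binco xi k ^ 2) K).
  apply (sum_bounded_Series (fun k => binco xi (K + k) ^ 2)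
    (INR K * binco xi K ^ 2 / c)).
  - intros k. apply pow2_ge_0.
  - intros n. apply Rle_div_r; [exact Hc|]. specialize (Hsum n).
    assert (0 <= (INR (K + n) + 1) * binco xi (S (K + n)) ^ 2).
    { apply Rmult_le_pos; [apply Rlt_le, INR_succ_pos | apply pow2_ge_0]. }
    lra.
Qed.

Lemma kerf_L2 (xi : R) : xi < -1/2 -> L2 (kerf xi).
Proof.
  intros H. apply (ex_series_ext (fun k => binco xi k ^ 2)); [|now apply binco_L2].
  intros k. symmetry. apply kerf_sqr.
Qed.

Lemma L2_lim_0 (f : nat -> R) : L2 f -> is_lim_seq f 0.
Proof.
  intros Hf. apply is_lim_seq_abs_0.
  apply (is_lim_seq_ext (fun k => sqrt (f k ^ 2))).
  { intros k. rewrite <- Rsqr_pow2. apply sqrt_Rsqr_abs. }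
  rewrite <- sqrt_0. apply (is_lim_seq_continuous sqrt).
  - apply continuity_pt_sqrt. lra.
  - now apply ex_series_lim_0.
Qed.

Lemma sin_plus_nat_PI (x : R) (k : nat) : sin (x + INR k * PI) = (-1) ^ k * sin x.
Proof.
  induction k as [|k IH].
  - simpl. rewrite Rmult_0_l, Rplus_0_r. ring.
  - rewrite S_INR. replace (x + (INR k + 1) * PI) with (x + INR k * PI + PI) by ring.
    rewrite neg_sin, IH. simpl. ring.
Qed.

Lemma sin_PI_shift (xi : R) (j k : nat) :
  sin (PI * (xi - (INR j - INR k))) = (-1) ^ j * (-1) ^ k * sin (PI * xi).
Proof.
  pose proof (sin_plus_nat_PI (PI * (xi - (INR j - INR k))) j) as H.
  replace (PI * (xi - (INR j - INR k)) + INR j * PI) with (PI * xi + INR k * PI)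
    in H by ring.
  rewrite sin_plus_nat_PI in H. pose proof (sqr_sign j) as Hj.
  transitivity ((-1) ^ j * ((-1) ^ k * sin (PI * xi))); [|ring].
  rewrite H, <- Rmult_assoc.
  replace ((-1) ^ j * (-1) ^ j) with (((-1) ^ j) ^ 2) by ring. rewrite Hj. ring.
Qed.

Lemma nonint_neq0 (xi : R) (j k : nat) :
  (forall z : Z, xi <> IZR z) -> xi - (INR j - INR k) <> 0.
Proof.
  intros H E. apply (H (Z.of_nat j - Z.of_nat k)%Z).
  rewrite minus_IZR, <- !INR_IZR_INZ. lra.
Qed.

(** The sign (-1)^k in [kerf] cancels the one in sin (PI (xi - j + k)), so row j is a constant times
    the sum of b_k / (xi - j + k). *)
Lemma kernel_term (xi : R) (j k : nat) :
  (forall z : Z, xi <> IZR z) ->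
  sinc (xi - (INR j - INR k)) * kerf xi k =
  (-1) ^ j * (sin (PI * xi) / PI) * (binco xi k / (xi - (INR j - INR k))).
Proof.
  intros H. pose proof (nonint_neq0 xi j k H) as Hn. pose proof PI_RGT_0.
  rewrite sinc_neq0, sin_PI_shift by exact Hn. unfold kerf.
  pose proof (sqr_sign k) as Hk.
  transitivity (((-1) ^ k) ^ 2 * ((-1) ^ j * (sin (PI * xi) / PI) *
     (binco xi k / (xi - (INR j - INR k))))).
  - field. lra.
  - rewrite Hk. ring.
Qed.

(* For j = 0 the junk value [pred 0 = 0] is multiplied by [INR 0]. In the limit this is the
   recurrence (xi - j) s_j + j s_{j-1} = 0, which forces every s_j to vanish. *)
Lemma kernel_telescope (xi : R) (j n : nat) :
  (forall z : Z, xi <> IZR z) ->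
  INR j * sum_f_R0 (fun k => binco xi k / (xi - (INR (pred j) - INR k))) n +
  (xi - INR j) * sum_f_R0 (fun k => binco xi k / (xi - (INR j - INR k))) n =
  binco xi (S n) * (INR (S n) / (xi - (INR j - INR (S n)))).
Proof.
  intros H.
  (* Since (j - 1) - k = j - (k + 1), the two sums share their denominators up to one index step;
     this is the source of the telescoping. *)
  assert (Hj : forall k, INR j * (binco xi k / (xi - (INR (pred j) - INR k))) =
                         INR j * (binco xi k / (xi - (INR j - INR (S k))))).
  { intros k. destruct j as [|i]; [simpl; ring|].
    simpl pred. rewrite !S_INR. f_equal. f_equal. ring. }
  induction n as [|n IH].
  - cbn [sum_f_R0]. rewrite Hj. pose proof (nonint_neq0 xi j 0 H) as H0.
    pose proof (nonint_neq0 xi j 1 H) as H1. cbn [binco]. simpl INR in *.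
    field. repeat split; lra.
  - cbn [sum_f_R0]. rewrite !Rmult_plus_distr_l, Hj.
    match goal with |- ?a + ?b + (?c + ?d) = _ =>
      transitivity ((a + c) + (b + d)); [ring|] end.
    rewrite IH.
    pose proof (nonint_neq0 xi j (S n) H) as H0.
    pose proof (nonint_neq0 xi j (S (S n)) H) as H1.
    change (binco xi (S (S n))) with
      (binco xi (S n) * ((INR (S n) + 1 + xi) / (INR (S n) + 1))).
    set (b := binco xi (S n)). clearbody b.
    rewrite (S_INR (S n)) in *. pose proof (INR_succ_pos (S n)).
    set (m := INR (S n)) in *. clearbody m.
    field. repeat split; lra.
Qed.

(** The quotient tends to 1, so the boundary term of the telescoping vanishes because
    square-summability gives b_n -> 0. *)
Lemma kerf_boundary (xi : R) (j : nat) :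
  xi < -1/2 ->
  is_lim_seq (fun n => binco xi (S n) * (INR (S n) / (xi - (INR j - INR (S n))))) 0.
Proof.
  intros Hxi.
  apply (is_lim_seq_incr_1 (fun n => binco xi n * (INR n / (xi - (INR j - INR n))))).
  replace 0 with (0 * 1) by ring.
  apply is_lim_seq_mult'; [now apply L2_lim_0, binco_L2|].
  apply (is_lim_seq_ext_loc (fun n => / (1 + (xi - INR j) * / INR n))).
  - destruct (INR_unbounded (INR j - xi)) as [K HK]. exists (S K). intros n Hn.
    apply le_INR in Hn. rewrite S_INR in Hn. pose proof (pos_INR K).
    field. repeat split; lra.
  - assert (HL : is_lim_seq (fun n => / (1 + (xi - INR j) * / INR n))
                   (Rbar_inv (Finite (1 + (xi - INR j) * 0)))).
    { apply is_lim_seq_inv; [|intros E; injection E; lra].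
      apply is_lim_seq_plus'; [apply is_lim_seq_const|].
      apply is_lim_seq_mult'; [apply is_lim_seq_const|].
      apply (is_lim_seq_inv _ p_infty); [apply is_lim_seq_INR | discriminate]. }
    simpl in HL. replace (/ (1 + (xi - INR j) * 0)) with 1 in HL by field. exact HL.
Qed.

Lemma toep_kerf (xi : R) (j : nat) :
  xi < -1/2 -> (forall z : Z, xi <> IZR z) -> toep xi (kerf xi) j = 0.
Proof.
  intros Hxi Hz.
  set (P := fun j n => sum_f_R0 (fun k => binco xi k / (xi - (INR j - INR k))) n).
  set (c := fun j => (-1) ^ j * (sin (PI * xi) / PI)).
  assert (Hlim : forall j, is_lim_seq (fun n => c j * P j n) (toep xi (kerf xi) j)).
  { intros i. pose proof (is_series_toep xi (kerf xi) i (kerf_L2 xi Hxi)) as H.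
    apply is_series_lim in H. revert H. apply is_lim_seq_ext. intros n.
    unfold P. rewrite scal_sum. apply sum_eq. intros k _.
    rewrite kernel_term by exact Hz. unfold c. ring. }
  (* The minus sign reflects [c (pred j)] = - [c j] for j > 0; at j = 0 the factor [INR 0] hides the
     mismatch. The coefficient xi - j is negative, so the recurrence can be solved from j = 0 on. *)
  assert (Hrec : forall j, INR j * - toep xi (kerf xi) (pred j) +
                 (xi - INR j) * toep xi (kerf xi) j = 0).
  { clear j. intros j. assert (E1 : is_lim_seq (fun n => INR j * - (c (pred j) * P (pred j) n) +
                                 (xi - INR j) * (c j * P j n))
      (INR j * - toep xi (kerf xi) (pred j) + (xi - INR j) * toep xi (kerf xi) j)).
    { apply is_lim_seq_plus'; apply is_lim_seq_mult'; try apply is_lim_seq_const.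
      - apply (is_lim_seq_opp (fun n => c (pred j) * P (pred j) n)
                 (Finite (toep xi (kerf xi) (pred j)))). apply Hlim.
      - apply Hlim. }
    assert (E2 : is_lim_seq (fun n => INR j * - (c (pred j) * P (pred j) n) +
                                 (xi - INR j) * (c j * P j n)) (c j * 0)).
    { apply (is_lim_seq_ext (fun n => c j *
        (binco xi (S n) * (INR (S n) / (xi - (INR j - INR (S n))))))).
      - intros n. rewrite <- kernel_telescope by exact Hz.
        fold (P j n). fold (P (pred j) n).
        destruct j as [|i]; [simpl; ring|]. unfold c. simpl pred. cbn [pow]. ring.
      - apply is_lim_seq_mult'; [apply is_lim_seq_const|].
        now apply kerf_boundary. }
    apply is_lim_seq_unique in E1. apply is_lim_seq_unique in E2.
    rewrite E1 in E2. injection E2. intros ->. ring. }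
  induction j as [|j IH].
  - specialize (Hrec 0%nat). simpl in Hrec. nra.
  - specialize (Hrec (S j)). simpl pred in Hrec. rewrite IH in Hrec.
    pose proof (pos_INR (S j)). nra.
Qed.

Lemma toep_kernel_nontrivial (xi : R) :
  xi < -1/2 -> exists f, L2 f /\ (forall j, toep xi f j = 0) /\ f 0%nat = 1.
Proof.
  intros Hxi. destruct (classic (forall z : Z, xi <> IZR z)) as [H|H].
  - exists (kerf xi). split; [now apply kerf_L2|]. split.
    + intros j. now apply toep_kerf.
    + unfold kerf. simpl. ring.
  - apply not_all_ex_not in H. destruct H as [z Hz].
    apply NNPP in Hz.
    (* For an integer xi <= -1 the quotients in [kernel_term] may divide by 0; but g_xi is then a
       negative power of z, and the constant function 1 is already in the kernel. *)
    exists (trunc 0 (fun _ => 1)). split; [apply L2_trunc|]. split; [|reflexivity].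
    intros j.
    rewrite <- (is_series_unique _ _ (is_series_toep xi _ j (L2_trunc 0 (fun _ => 1)))).
    rewrite (is_series_unique _ _ (is_series_trunc 0 (fun _ => 1) _)).
    cbn [sum_f_R0]. rewrite Hz, !INR_IZR_INZ, <- !minus_IZR, sinc_IZR; [ring|].
    assert (IZR z < IZR 0) by (rewrite <- Hz; simpl; lra).
    apply lt_IZR in H. lia.
Qed.

(** * Failure of boundedness below at xi = -1/2 + n *)

Lemma sin_sqr_le (y : R) : sin y ^ 2 <= y ^ 2.
Proof.
  assert (H : forall x, 0 < x -> sin x ^ 2 <= x ^ 2).
  { intros x Hx. pose proof (sin_lt_x x Hx).
    assert (- x <= sin x).
    { destruct (Rle_lt_dec x PI).
      - pose proof (sin_ge_0 x ltac:(lra) ltac:(lra)). lra.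
      - pose proof (SIN_bound x). pose proof PI2_1. lra. }
    nra. }
  destruct (Rtotal_order y 0) as [Hy|[->|Hy]].
  - specialize (H (- y) ltac:(lra)). rewrite sin_neg in H. nra.
  - rewrite sin_0. lra.
  - now apply H.
Qed.

(** The squared chord is 4 sin (PI (a - b) x)^2, and |x| <= 1/2 absorbs the factor 4. *)
Lemma symbol_le_diff (a b : R) :
  a <> b ->
  symbol_le (fun x => 1 * gcos a x + -1 * gcos b x)
    (fun x => 1 * gsin a x + -1 * gsin b x) (PI * Rabs (a - b)).
Proof.
  intros Hab. pose proof PI_RGT_0 as HPI.
  destruct (symbol_le_g a) as (HA & HB & _). destruct (symbol_le_g b) as (HA' & HB' & _).
  repeat split.
  - intros x. now apply (continuous_lincomb (gcos a) (gcos b)).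
  - intros x. now apply (continuous_lincomb (gsin a) (gsin b)).
  - apply Rmult_lt_0_compat; [exact HPI|]. apply Rabs_pos_lt. lra.
  - intros x Hx. rewrite Rpow_mult_distr, <- (Rsqr_pow2 (Rabs _)), <- Rsqr_abs, Rsqr_pow2.
    unfold gcos, gsin. set (p := 2 * PI * a * x). set (q := 2 * PI * b * x).
    pose proof (sin2_cos2 p) as Hp. pose proof (sin2_cos2 q) as Hq.
    rewrite !Rsqr_pow2 in Hp, Hq.
    assert (E : (1 * cos p + -1 * cos q) ^ 2 + (1 * sin p + -1 * sin q) ^ 2 =
                4 * sin (PI * (a - b) * x) ^ 2).
    { transitivity (2 - 2 * cos (p - q)).
      - rewrite cos_minus. nra.
      - replace (p - q) with (2 * (PI * (a - b) * x)) by (unfold p, q; ring).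
        rewrite cos_2a_sin. ring. }
    rewrite E. pose proof (sin_sqr_le (PI * (a - b) * x)) as Hs.
    rewrite !Rpow_mult_distr in Hs.
    assert (0 <= PI ^ 2 * (a - b) ^ 2)
      by (apply Rmult_le_pos; apply pow2_ge_0).
    assert (x ^ 2 <= 1/4) by nra. nra.
Qed.

Lemma toep_near_kernel (a b : R) (f : nat -> R) :
  a <> b -> L2 f -> (forall j, toep b f j = 0) ->
  nrm (toep a f) <= PI * Rabs (a - b) * nrm f.
Proof.
  intros Hab Hf HT.
  eapply Rle_trans; [|apply (op_bound _ _ _ f (symbol_le_diff a b Hab) Hf)].
  apply Req_le, nrm_ext. intros j.
  rewrite (op_symbol_lincomb (gcos a) (gsin a) (gcos b) (gsin b) 1 1)
    by (try apply symbol_le_g; exact Hf).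
  fold (toep a) (toep b). rewrite HT. ring.
Qed.

(** The squares decay like 1 / k, the borderline of summability. The constant 1/4 is attained at k =
    0, and the induction step amounts to (m + 3/2)^2 >= (m + 1) (m + 2). *)
Lemma binco_half_lower (k : nat) : 1 / (4 * (INR k + 1)) <= binco (-1/2) (S k) ^ 2.
Proof.
  induction k as [|k IH].
  - simpl. lra.
  - change (binco (-1/2) (S (S k))) with
      (binco (-1/2) (S k) * ((INR (S k) + 1 + -1/2) / (INR (S k) + 1))).
    rewrite Rpow_mult_distr. rewrite S_INR. pose proof (pos_INR k) as Hk.
    set (m := INR k) in *. set (b := binco (-1/2) (S k) ^ 2) in *. clearbody m b.
    apply Rle_trans with (1 / (4 * (m + 1)) * ((m + 1 + 1 + -1/2) / (m + 1 + 1)) ^ 2).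
    + apply Rminus_le_0.
      replace (1 / (4 * (m + 1)) * ((m + 1 + 1 + -1/2) / (m + 1 + 1)) ^ 2 -
               1 / (4 * (m + 1 + 1))) with (1 / (16 * (m + 1) * (m + 2) ^ 2))
        by (field; lra).
      apply Rlt_le, Rdiv_lt_0_compat; [lra|]. repeat apply Rmult_lt_0_compat; nra.
    + apply Rmult_le_compat_r; [apply pow2_ge_0 | exact IH].
Qed.

Lemma ln_succ_le (x : R) : 0 < x -> ln (x + 1) <= ln x + / x.
Proof.
  intros Hx. replace (x + 1) with (x * (1 + / x)) by (field; lra).
  pose proof (Rinv_0_lt_compat x Hx) as Hi.
  rewrite ln_mult by lra. apply Rplus_le_compat_l.
  rewrite <- (ln_exp (/ x)) at 2. apply ln_le; [lra|].
  apply Rlt_le, exp_ineq1. lra.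
Qed.

Lemma binco_half_diverges (n : nat) :
  ln (INR n + 1) / 4 <= sum_f_R0 (fun k => binco (-1/2) k ^ 2) n.
Proof.
  induction n as [|n IH].
  - simpl. rewrite Rplus_0_l, ln_1. lra.
  - cbn [sum_f_R0]. rewrite S_INR. pose proof (binco_half_lower n) as H.
    pose proof (INR_succ_pos n) as Hn. pose proof (ln_succ_le (INR n + 1) Hn).
    replace (1 / (4 * (INR n + 1))) with (/ (INR n + 1) / 4) in H by (field; lra).
    lra.
Qed.

Lemma binco_continuous (d : nat -> R) (xi : R) (k : nat) :
  is_lim_seq d xi -> is_lim_seq (fun m => binco (d m) k) (binco xi k).
Proof.
  intros Hd. induction k as [|k IH]; cbn [binco]; [apply is_lim_seq_const|].
  apply is_lim_seq_mult'; [exact IH|].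
  apply is_lim_seq_mult'; [|apply is_lim_seq_const].
  apply is_lim_seq_plus'; [apply is_lim_seq_const | exact Hd].
Qed.

Lemma kerf_le_1 (xi : R) (k : nat) : -1 <= xi <= 0 -> kerf xi k ^ 2 <= 1.
Proof.
  intros Hxi. rewrite kerf_sqr.
  assert (H : 0 <= binco xi k <= 1).
  { induction k as [|k IH]; cbn [binco]; [lra|].
    pose proof (pos_INR k).
    assert (0 <= (INR k + 1 + xi) / (INR k + 1) <= 1).
    { split; [apply Rdiv_le_0_compat; lra|]. apply Rle_div_l; lra. }
    nra. }
  nra.
Qed.

(** The limiting sequence at -1/2 has infinite norm, so finitely many coordinates already carry more
    than M^2 + 1 there; their finite sum is continuous in xi, and the margin 1 pays for moving to
    -1/2 - d. The bound d < 1/2 keeps the parameter in (-1, -1/2), away from integers. *)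
Lemma nrm_kerf_unbounded (eps M : R) :
  0 < eps -> exists d, 0 < d < eps /\ d < 1/2 /\ M < nrm (kerf (-1/2 - d)).
Proof.
  intros Heps.
  destruct (INR_unbounded (exp (4 * (M ^ 2 + 1)))) as [N HN].
  assert (HS : M ^ 2 + 1 < sum_f_R0 (fun k => binco (-1/2) k ^ 2) N).
  { eapply Rlt_le_trans; [|apply binco_half_diverges].
    assert (4 * (M ^ 2 + 1) < ln (INR N + 1)); [|lra].
    rewrite <- (ln_exp (4 * (M ^ 2 + 1))). apply ln_increasing; [apply exp_pos | lra]. }
  set (d := fun m => / INR (S m)).
  assert (Hd : is_lim_seq d 0).
  { apply (is_lim_seq_incr_1 (fun m => / INR m)).
    apply (is_lim_seq_inv _ p_infty); [apply is_lim_seq_INR | discriminate]. }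
  assert (HL : is_lim_seq (fun m => sum_f_R0 (fun k => binco (-1/2 - d m) k ^ 2) N)
                 (sum_f_R0 (fun k => binco (-1/2) k ^ 2) N)).
  { apply (is_lim_seq_sum (fun m k => binco (-1/2 - d m) k ^ 2)). intros k.
    apply (is_lim_seq_sqr (fun m => binco (-1/2 - d m) k)).
    apply binco_continuous. rewrite <- (Rminus_0_r (-1/2)) at 1.
    apply is_lim_seq_minus'; [apply is_lim_seq_const | exact Hd]. }
  apply is_lim_seq_spec in HL. apply is_lim_seq_spec in Hd.
  assert (He : 0 < Rmin eps (1/2)) by (apply Rmin_pos; lra).
  destruct (HL (mkposreal 1 Rlt_0_1)) as [N1 H1].
  destruct (Hd (mkposreal _ He)) as [N2 H2].
  set (m := max N1 N2). specialize (H1 m ltac:(lia)). specialize (H2 m ltac:(lia)).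
  cbn [pos] in H1, H2. rewrite Rminus_0_r in H2.
  apply Rabs_lt_between in H1. apply Rabs_lt_between in H2.
  pose proof (Rmin_l eps (1/2)). pose proof (Rmin_r eps (1/2)).
  assert (Hd0 : 0 < d m).
  { apply Rinv_0_lt_compat, lt_0_INR. lia. }
  exists (d m). repeat split; try lra.
  assert (HK : L2 (kerf (-1/2 - d m))) by (apply kerf_L2; lra).
  pose proof (sum_le_nrm _ N HK) as H3.
  rewrite (sum_eq _ (fun k => binco (-1/2 - d m) k ^ 2)) in H3
    by (intros; apply kerf_sqr).
  pose proof (nrm_nonneg (kerf (-1/2 - d m))).
  assert (M ^ 2 < nrm (kerf (-1/2 - d m)) ^ 2) by lra. nra.
Qed.

Lemma shift_drop (n : nat) (h : nat -> R) :
  (forall k, (k < n)%nat -> h k = 0) ->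
  forall k, shift n (fun i => h (n + i)%nat) k = h k.
Proof.
  intros H k. unfold shift. destruct (lt_dec k n) as [Hk|Hk].
  - now rewrite H.
  - f_equal. lia.
Qed.

Lemma op_ext (A B : R -> R) (f g : nat -> R) (j : nat) :
  (forall k, f k = g k) -> op A B f j = op A B g j.
Proof. intros H. apply Series_ext. intros k. now rewrite H. Qed.

(* Kernel vectors of T_{-1/2-d} are almost annihilated by T_{-1/2}; their norms blow up as
   d -> 0 while each coordinate stays bounded, so deleting the first coordinates, which is
   what T_{-1/2+n} = T_{-1/2} S^n requires, costs nothing asymptotically. *)
Lemma toep_half_not_bounded_below (n : nat) (c : R) :
  0 < c -> ~ (forall f, L2 f -> c * nrm f <= nrm (toep (-1/2 + INR n) f)).
Proof.
  intros Hc H. pose proof PI_RGT_0 as HPI.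
  (* B bounds the norm of the n + 1 deleted coordinates, each at most 1 in absolute value whatever d
     is. *)
  set (B := sqrt (INR (S n))).
  assert (HB : 0 <= B) by apply sqrt_pos.
  (* The first constant makes PI d <= c / 2. Then c (|f| - B) <= (c / 2) |f| + B, that is |f| <= 2
     (1 + c) B / c, which the second constant contradicts. *)
  destruct (nrm_kerf_unbounded (c / (2 * PI)) (2 * (1 + c) * B / c))
    as (d & Hd & Hd2 & Hnrm).
  { apply Rdiv_lt_0_compat; lra. }
  set (xi := -1/2 - d) in *. set (f := kerf xi) in *.
  assert (Hf : L2 f) by (apply kerf_L2; unfold xi; lra).
  assert (HT : forall j, toep xi f j = 0).
  { intros j. apply toep_kerf; [unfold xi; lra|]. intros z Hz.
    assert (Hz1 : -1 < IZR z) by (unfold xi in Hz; lra).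
    assert (Hz2 : IZR z < 0) by (unfold xi in Hz; lra).
    apply lt_IZR in Hz1, Hz2. lia. }
  set (e := fun k => f k - trunc n f k).
  assert (He : L2 e) by (apply L2_minus; [exact Hf | apply L2_trunc]).
  set (g := fun k => e (n + k)%nat).
  assert (Hg : L2 g) by now apply (ex_series_incr_n (fun k => e k ^ 2) n).
  assert (Hge : forall k, shift n g k = e k).
  { apply shift_drop. intros k Hk. unfold e, trunc.
    destruct (le_dec k n); [ring | lia]. }
  assert (Htr : nrm (trunc n f) <= B).
  { apply Rsqr_incr_0; [|apply nrm_nonneg | exact HB].
    unfold B. rewrite Rsqr_sqrt by apply pos_INR. rewrite Rsqr_pow2, nrm_trunc_sqr.
    eapply Rle_trans; [apply sum_Rle with (Bn := fun _ => 1)|].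
    - intros k _. apply kerf_le_1. unfold xi. lra.
    - rewrite sum_cte. lra. }
  specialize (H g Hg).
  assert (Eg : nrm g = nrm e).
  { rewrite <- (proj2 (nrm_shift n g Hg)). now apply nrm_ext. }
  assert (ET : nrm (toep (-1/2 + INR n) g) <= PI * d * nrm f + B).
  { rewrite (nrm_ext (toep (-1/2 + INR n) g)
       (fun j => toep (-1/2) f j + -1 * toep (-1/2) (trunc n f) j)).
    2: { intros j. rewrite toep_shift by exact Hg. unfold toep.
         rewrite (op_ext _ _ (shift n g) e) by exact Hge.
         unfold e. rewrite (op_minus _ _ 1);
           [ring | apply symbol_le_g | exact Hf | apply L2_trunc]. }
    destruct (toep_bound (-1/2) f Hf) as [L1 _].
    destruct (toep_bound (-1/2) _ (L2_trunc n f)) as [L3 L4].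
    eapply Rle_trans; [apply nrm_triangle; [exact L1 | now apply L2_scal]|].
    rewrite nrm_scal, (Rabs_left (-1)) by lra.
    pose proof (toep_near_kernel (-1/2) xi f ltac:(unfold xi; lra) Hf HT) as HN.
    replace (-1/2 - xi) with d in HN by (unfold xi; lra).
    rewrite (Rabs_pos_eq d) in HN by lra. lra. }
  assert (Efe : nrm f <= nrm e + B).
  { rewrite (nrm_ext f (fun k => e k + trunc n f k)) by (intros; unfold e; ring).
    eapply Rle_trans; [apply nrm_triangle; [exact He | apply L2_trunc]|]. lra. }
  rewrite Eg in H.
  assert (Hd3 : PI * d <= c / 2).
  { destruct Hd as [_ Hd]. apply (Rmult_lt_compat_l PI) in Hd; [|exact HPI].
    replace (PI * (c / (2 * PI))) with (c / 2) in Hd by (field; lra). lra. }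
  apply Rlt_div_l in Hnrm; [|exact Hc].
  pose proof (nrm_nonneg f). nra.
Qed.

(** * Reduction of the complex operator to real sequences *)

Definition re_seq (f : seqC) (k : nat) : R := fst (f k).
Definition im_seq (f : seqC) (k : nat) : R := snd (f k).
Definition real_seq (f : nat -> R) : seqC := fun k => (f k, 0).

Lemma is_l2_iff (f : seqC) : is_l2 f <-> L2 (re_seq f) /\ L2 (im_seq f).
Proof.
  split.
  - intros [l Hl]. apply is_series_Reals in Hl.
    assert (He : ex_series (fun k => Cnorm2 (f k))) by now exists l.
    split; refine (@ex_series_le R_AbsRing R_CompleteNormedModule _ _ _ He);
      intros k; unfold norm; simpl; unfold abs; simpl; unfold Cnorm2, re_seq, im_seq;
      rewrite Rabs_pos_eq; nra.
  - intros [H1 H2]. destruct (ex_series_plus _ _ H1 H2) as [l Hl].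
    exists l. apply is_series_Reals. exact Hl.
Qed.

Lemma l2norm2_iff (f : seqC) (l : R) :
  L2 (re_seq f) -> L2 (im_seq f) ->
  l2norm2 f l <-> l = nrm (re_seq f) ^ 2 + nrm (im_seq f) ^ 2.
Proof.
  intros H1 H2.
  assert (H : l2norm2 f (nrm (re_seq f) ^ 2 + nrm (im_seq f) ^ 2)).
  { apply is_series_Reals. rewrite !nrm_sqr by assumption.
    apply (is_series_plus (fun k => re_seq f k ^ 2) (fun k => im_seq f k ^ 2));
      now apply Series_correct. }
  split.
  - intros Hl. now apply (uniqueness_sum (fun k => Cnorm2 (f k))).
  - now intros ->.
Qed.

Lemma toeplitz_iff (xi : R) (f h : seqC) :
  L2 (re_seq f) -> L2 (im_seq f) ->
  toeplitz xi f h <->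
  (forall j, re_seq h j = toep xi (re_seq f) j) /\
  (forall j, im_seq h j = toep xi (im_seq f) j).
Proof.
  intros H1 H2.
  assert (Hre : forall j, infinite_sum (fun k => fst (Cmul
    (ghat xi (Z.of_nat j - Z.of_nat k)) (f k))) (toep xi (re_seq f) j)).
  { intros j. apply is_series_Reals.
    apply (is_series_ext (fun k => sinc (xi - (INR j - INR k)) * re_seq f k));
      [|now apply is_series_toep].
    intros k. real_eq. rewrite ghat_sinc, minus_IZR, <- !INR_IZR_INZ.
    unfold Cmul, re_seq; simpl. ring. }
  assert (Him : forall j, infinite_sum (fun k => snd (Cmul
    (ghat xi (Z.of_nat j - Z.of_nat k)) (f k))) (toep xi (im_seq f) j)).
  { intros j. apply is_series_Reals.
    apply (is_series_ext (fun k => sinc (xi - (INR j - INR k)) * im_seq f k));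
      [|now apply is_series_toep].
    intros k. real_eq. rewrite ghat_sinc, minus_IZR, <- !INR_IZR_INZ.
    unfold Cmul, im_seq; simpl. ring. }
  split.
  - intros HT. split; intros j; destruct (HT j) as [Ha Hb].
    + exact (uniqueness_sum _ _ _ Ha (Hre j)).
    + exact (uniqueness_sum _ _ _ Hb (Him j)).
  - intros [Ha Hb] j. fold (re_seq h j) (im_seq h j). rewrite Ha, Hb. now split.
Qed.

Lemma toep_zero (xi : R) (j : nat) : toep xi (fun _ => 0) j = 0.
Proof.
  destruct nrm_zero as [H0 E]. destruct (toep_bound xi _ H0) as [H1 H2].
  apply nrm_eq_0; [exact H1 | lra].
Qed.

Lemma L2_real_seq (f : nat -> R) :
  L2 f -> L2 (re_seq (real_seq f)) /\ L2 (im_seq (real_seq f)).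
Proof. intros Hf. split; [exact Hf | apply nrm_zero]. Qed.

Definition toep_inj (xi : R) : Prop :=
  forall f, L2 f -> (forall j, toep xi f j = 0) -> forall k, f k = 0.

Definition toep_bdd_below (xi : R) : Prop :=
  exists c, 0 < c /\ forall f, L2 f -> c * nrm f <= nrm (toep xi f).

Definition toep_surj (xi : R) : Prop :=
  forall h, L2 h -> exists f, L2 f /\ forall j, toep xi f j = h j.

Lemma T_injective_iff (xi : R) : T_injective xi <-> toep_inj xi.
Proof.
  split.
  - intros H f Hf HT k. destruct (L2_real_seq f Hf) as [H1 H2].
    assert (E : real_seq f k = (0, 0)).
    { apply H; [apply is_l2_iff; now split|].
      apply toeplitz_iff; [exact H1 | exact H2 |]. split; intros j.
      - symmetry. apply HT.
      - symmetry. apply toep_zero. }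
    now injection E.
  - intros H f Hf HT k. apply is_l2_iff in Hf. destruct Hf as [H1 H2].
    apply toeplitz_iff in HT; [|exact H1 | exact H2]. destruct HT as [Ha Hb].
    assert (E1 : re_seq f k = 0) by (apply H; [exact H1 | intros j; now rewrite <- Ha]).
    assert (E2 : im_seq f k = 0) by (apply H; [exact H2 | intros j; now rewrite <- Hb]).
    unfold re_seq, im_seq in *. destruct (f k). simpl in *. now subst.
Qed.

Lemma T_bounded_below_iff (xi : R) : T_bounded_below xi <-> toep_bdd_below xi.
Proof.
  split.
  - intros (c & Hc & H). exists c. split; [exact Hc|]. intros f Hf.
    destruct (L2_real_seq f Hf) as [H1 H2].
    destruct (toep_bound xi f Hf) as [H3 _]. destruct (L2_real_seq _ H3) as [H4 H5].
    assert (E : forall g, L2 g -> l2norm2 (real_seq g) (nrm g ^ 2)).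
    { intros g Hg. destruct (L2_real_seq g Hg). apply l2norm2_iff; [assumption..|].
      change (im_seq (real_seq g)) with (fun _ : nat => 0).
      rewrite (proj2 nrm_zero), (nrm_ext (re_seq (real_seq g)) g) by reflexivity. ring. }
    specialize (H (real_seq f) (real_seq (toep xi f)) (nrm f ^ 2) (nrm (toep xi f) ^ 2)).
    rewrite !sqrt_pow2 in H by apply nrm_nonneg. apply Rge_le, H.
    + apply is_l2_iff. now split.
    + apply toeplitz_iff; [exact H1 | exact H2 |]. split; intros j; [reflexivity|].
      symmetry. apply toep_zero.
    + now apply E.
    + now apply E.
  - intros (c & Hc & H). exists c. split; [exact Hc|].
    intros f h nf nh Hf HT Hnf Hnh. apply is_l2_iff in Hf. destruct Hf as [H1 H2].
    apply toeplitz_iff in HT; [|exact H1 | exact H2]. destruct HT as [Ha Hb].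
    destruct (toep_bound xi _ H1) as [H3 _]. destruct (toep_bound xi _ H2) as [H4 _].
    apply l2norm2_iff in Hnf; [|exact H1 | exact H2].
    apply l2norm2_iff in Hnh;
      [|now apply (L2_ext (toep xi (re_seq f))) | now apply (L2_ext (toep xi (im_seq f)))].
    rewrite (nrm_ext (re_seq h) _ Ha), (nrm_ext (im_seq h) _ Hb) in Hnh.
    pose proof (H _ H1) as I1. pose proof (H _ H2) as I2.
    pose proof (nrm_nonneg (re_seq f)). pose proof (nrm_nonneg (im_seq f)).
    apply Rle_ge. rewrite <- (sqrt_pow2 c) at 1 by lra.
    rewrite <- sqrt_mult_alt by apply pow2_ge_0. apply sqrt_le_1_alt. subst nf nh.
    rewrite Rmult_plus_distr_l, <- !Rpow_mult_distr.
    apply Rplus_le_compat; apply pow_incr; split; try assumption; nra.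
Qed.

Lemma T_surjective_iff (xi : R) : T_surjective xi <-> toep_surj xi.
Proof.
  split.
  - intros H h Hh. destruct (H (real_seq h)) as (f & Hf & HT).
    + apply is_l2_iff. now apply L2_real_seq.
    + apply is_l2_iff in Hf. destruct Hf as [H1 H2].
      apply toeplitz_iff in HT; [|exact H1 | exact H2].
      exists (re_seq f). split; [exact H1|]. intros j. symmetry. apply HT.
  - intros H h Hh. apply is_l2_iff in Hh. destruct Hh as [H1 H2].
    destruct (H _ H1) as (p & Hp & Ep). destruct (H _ H2) as (q & Hq & Eq).
    exists (fun k => (p k, q k)). split.
    + apply is_l2_iff. now split.
    + apply toeplitz_iff; [exact Hp | exact Hq |].
      split; intros j; symmetry; [apply Ep | apply Eq].
Qed.

Lemma toep_inj_shift (xi : R) (n : nat) : toep_inj xi -> toep_inj (xi + INR n).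
Proof.
  intros H f Hf HT k. destruct (nrm_shift n f Hf) as [Hs _].
  assert (E : shift n f (n + k) = 0).
  { apply H; [exact Hs|]. intros j. now rewrite <- toep_shift. }
  unfold shift in E. destruct (lt_dec (n + k) n); [lia|].
  now replace (n + k - n)%nat with k in E by lia.
Qed.

Lemma toep_bdd_below_shift (xi : R) (n : nat) :
  toep_bdd_below xi -> toep_bdd_below (xi + INR n).
Proof.
  intros (c & Hc & H). exists c. split; [exact Hc|]. intros f Hf.
  destruct (nrm_shift n f Hf) as [Hs <-].
  rewrite (nrm_ext (toep (xi + INR n) f) (toep xi (shift n f)))
    by (intros j; now apply toep_shift).
  now apply H.
Qed.

(** If T_xi e_0 were T_{xi+n} f = T_xi S^n f, injectivity of T_xi would give S^n f = e_0, although
    S^n f vanishes at index 0. *)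
Lemma toep_shift_not_surj (xi : R) (n : nat) :
  (0 < n)%nat -> toep_inj xi -> ~ toep_surj (xi + INR n).
Proof.
  intros Hn Hinj Hsurj. set (e := trunc 0 (fun _ => 1)).
  assert (He : L2 e) by apply L2_trunc.
  destruct (Hsurj (toep xi e)) as (f & Hf & HT); [now apply toep_bound|].
  destruct (nrm_shift n f Hf) as [Hs _].
  assert (E : shift n f 0 - e 0%nat = 0).
  { apply (Hinj (fun k => shift n f k - e k)); [now apply L2_minus|].
    intros j. unfold toep. rewrite (op_minus _ _ 1) by (auto; apply symbol_le_g).
    fold (toep xi). rewrite <- toep_shift, HT by exact Hf. ring. }
  unfold shift, e, trunc in E. destruct (lt_dec 0 n); [|lia].
  destruct (le_dec 0 0); [lra | lia].
Qed.

Theorem theorem1p2 :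
  (forall xi : R, xi < -1/2 -> ~ T_injective xi) /\
  (forall xi : R, -1/2 < xi < 1/2 -> T_invertible xi) /\
  (forall (xi : R) (n : nat), xi = -1/2 + INR n ->
      T_injective xi /\ ~ T_bounded_below xi) /\
  (forall xi : R, xi > 1/2 -> (forall n : nat, xi <> -1/2 + INR n) ->
      T_injective xi /\ T_bounded_below xi /\ ~ T_surjective xi).
Proof.
  repeat apply conj.
  - intros xi Hxi H. rewrite T_injective_iff in H.
    destruct (toep_kernel_nontrivial xi Hxi) as (f & Hf & HT & H0).
    rewrite (H f Hf HT) in H0. lra.
  - intros xi Hxi. unfold T_invertible.
    rewrite T_injective_iff, T_surjective_iff, T_bounded_below_iff.
    repeat split.
    + intros f. now apply toep_injective.
    + intros h. now apply toep_surjective.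
    + now apply toep_bounded_below.
  - intros xi n ->. rewrite T_injective_iff, T_bounded_below_iff. split.
    + apply toep_inj_shift. exact toep_half_injective.
    + intros (c & Hc & H). now apply (toep_half_not_bounded_below n c).
  - intros xi Hxi Hn.
    (* The floor puts xi - n in [-1/2, 1/2), and [Hn] excludes the left end. As xi > 1/2, this n is
       positive, which non-surjectivity requires. *)
    destruct (nfloor_ex (xi + 1/2)) as [n [Hn1 Hn2]]; [lra|].
    assert (Hx : -1/2 < xi - INR n < 1/2).
    { specialize (Hn n). split; [|lra].
      destruct (Rle_lt_or_eq_dec _ _ Hn1); lra. }
    replace xi with (xi - INR n + INR n) by ring.
    rewrite T_injective_iff, T_bounded_below_iff, T_surjective_iff.
    assert (Hinj : toep_inj (xi - INR n)) by (intros f; now apply toep_injective).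
    repeat split.
    + now apply toep_inj_shift.
    + apply toep_bdd_below_shift. now apply toep_bounded_below.
    + apply toep_shift_not_surj; [|exact Hinj].
      apply INR_lt. simpl. lra.
Qed.
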